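(* Let $\mathcal{C}$ be the double-pentagram configuration of $16$ points and $15$ lines (defined in the context), regarded as lying in the real projective plane $\mathbf{P}^2(\mathbf{R})$. Then the group of projective linear transformations of $\mathbf{P}^2(\mathbf{R})$ preserving $\mathcal{C}$ (mapping its set of $16$ points to itself and its set of $15$ lines to itself) is isomorphic to the alternating group $A_5$. This group acts transitively on the $15$ lines, and its orbits on the $16$ points have sizes $6$ and $10$; the $6$-point orbit consists of the central point and the five points of the middle ring.
   Context: The configuration $\mathcal{C}$ is constructed in the Euclidean plane as follows. Take a regular pentagon with center $O$ and let the outer pentagram be the five lines containing its diagonals. These five lines meet in pairs in $10$ points: the $5$ vertices of the pentagon (the outer ring) and the $5$ vertices of a smaller regular pentagon centered at $O$ (the middle ring). Let the inner pentagram be the five lines containing the diagonals of this smaller pentagon; they meet in pairs in the $5$ points of the middle ring and in $5$ further points (the inner ring), the vertices of a still smaller regular pentagon centered at $O$. The $16$ points of $\mathcal{C}$ are $O$ and the points of the outer, middle and inner rings. The $15$ lines of $\mathcal{C}$ are the five lines of the outer pentagram, the five lines of the inner pentagram, and the five axes of symmetry of the pentagon (all through $O$). Each of the $15$ lines contains exactly four of the $16$ points. *)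

(* Defs.v *)
From HB Require Import structures.
From mathcomp Require Import all_boot all_order all_algebra all_fingroup all_solvable.
From mathcomp Require Import all_classical all_reals all_analysis.

Set Implicit Arguments.
Unset Strict Implicit.
Unset Printing Implicit Defensive.

Import Order.TTheory GRing.Theory Num.Theory.

Local Open Scope classical_set_scope.
Local Open Scope ring_scope.

Definition plane (R : realType) : Type := (R * R)%type.

Definition line_through (R : realType) (p q : plane R) : set (plane R) :=
  [set ((1 - t) * p.1 + t * q.1, (1 - t) * p.2 + t * q.2) | t in [set: R]].

(* Foot of the perpendicular from x to the line through p and q (p != q). *)
Definition foot (R : realType) (p q x : plane R) : plane R :=
  let u := (q.1 - p.1, q.2 - p.2) in
  let t := ((x.1 - p.1) * u.1 + (x.2 - p.2) * u.2) / (u.1 ^+ 2 + u.2 ^+ 2) in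
  (p.1 + t * u.1, p.2 + t * u.2).

Definition reflection (R : realType) (p q x : plane R) : plane R :=
  let f := foot p q x in (2 * f.1 - x.1, 2 * f.2 - x.2).

Definition symmetry_axes (R : realType) (P : set (plane R)) :
    set (set (plane R)) :=
  [set l | exists p q, [/\ p <> q, l = line_through p q
                         & reflection p q @` P = P]].

(* v lists, in counterclockwise order, the vertices of a regular pentagon
   with center O; r is the circumradius. *)
Definition regular_pentagon_labelling (R : realType) (O : plane R)
    (v : 'I_5 -> plane R) : Prop :=
  exists r theta : R, 0 < r /\
    forall k : 'I_5,
      v k = (O.1 + r * cos (theta + 2 * pi * (k : nat)%:R / 5),
             O.2 + r * sin (theta + 2 * pi * (k : nat)%:R / 5)).

(* Pentagons are identified with their vertex sets. *)
Definition regular_pentagon (R : realType) (O : plane R) (P : set (plane R)) :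
    Prop :=
  exists2 v, regular_pentagon_labelling O v & P = range v.

(* The lines containing the diagonals of the pentagon P; the addition k + 2 is
   that of the ring 'I_5 of integers modulo 5. *)
Definition pentagram (R : realType) (O : plane R) (P : set (plane R)) :
    set (set (plane R)) :=
  [set l | exists v, [/\ regular_pentagon_labelling O v, P = range v
                       & exists k : 'I_5, l = line_through (v k) (v (k + 2))]].

Definition meeting_points (R : realType) (L : set (set (plane R))) :
    set (plane R) :=
  [set x | exists l1 l2, [/\ L l1, L l2, l1 <> l2, l1 x & l2 x]].

(* The points other than the vertices of P where the pentagram of P meets
   itself. *)
Definition next_ring (R : realType) (O : plane R) (P : set (plane R)) :
    set (plane R) :=
  meeting_points (pentagram O P) `\` P.

(* The configuration built from the pentagon P with center O: P is the outer
   ring, next_ring O P the middle ring and next_ring O (next_ring O P) the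
   inner ring. *)
Definition config_points (R : realType) (O : plane R) (P : set (plane R)) :
    set (plane R) :=
  [set O] `|` P `|` next_ring O P `|` next_ring O (next_ring O P).

Definition config_lines (R : realType) (O : plane R) (P : set (plane R)) :
    set (set (plane R)) :=
  pentagram O P `|` pentagram O (next_ring O P) `|` symmetry_axes P.

Definition proj_plane (R : realType) : Type :=
  {U : {vspace 'rV[R]_3} | \dim U == 1%N}.

Definition proj_line (R : realType) (l : set (proj_plane R)) : Prop :=
  exists2 U : {vspace 'rV[R]_3}, \dim U = 2%N
    & l = [set p | (val p <= U)%VS].

Definition homogeneous (R : realType) (x : plane R) : 'rV[R]_3 :=
  \row_(i < 3) [:: x.1; x.2; 1]`_i.

Lemma dim_homogeneous (R : realType) (x : plane R) :
  \dim <[homogeneous x]> == 1%N.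
Proof.
rewrite dim_vline eqb1; apply/eqP => /rowP /(_ (inord 2)).
by rewrite !mxE inordK //= => /eqP; rewrite oner_eq0.
Qed.

Definition embed (R : realType) (x : plane R) : proj_plane R :=
  exist _ <[homogeneous x]>%VS (dim_homogeneous x).

(* The projective completions of the Euclidean lines in L. *)
Definition completions (R : realType) (L : set (set (plane R))) :
    set (set (proj_plane R)) :=
  [set l | proj_line l /\ exists2 m, L m & (@embed R) @` m `<=` l].

Definition proj_linear (R : realType) (f : proj_plane R -> proj_plane R) :
    Prop :=
  exists2 g : 'End('rV[R]_3), lker g == 0%VS
    & forall p, val (f p) = (g @: val p)%VS.

Lemma proj_linear_id (R : realType) : proj_linear (@id (proj_plane R)).
Proof.
exists \1%VF => [|p]; last by rewrite lim1g.
by apply/lker0P => u v; rewrite !lfunE.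
Qed.

Lemma proj_linear_comp (R : realType) (f1 f2 : proj_plane R -> proj_plane R) :
  proj_linear f1 -> proj_linear f2 -> proj_linear (f1 \o f2).
Proof.
move=> [g1 k1 e1] [g2 k2 e2]; exists (g1 \o g2)%VF => [|p].
  by apply/lker0P => u v; rewrite !lfunE /= => /(lker0P k1) /(lker0P k2).
by rewrite /= e1 e2 limg_comp.
Qed.

Lemma proj_linear_inv (R : realType) (f : proj_plane R -> proj_plane R) :
  proj_linear f -> exists h, [/\ proj_linear h, cancel f h & cancel h f].
Proof.
move=> [g kg ef].
have kg' : lker (g^-1)%VF == 0%VS.
  by apply/lker0P => u v; exact: (can_inj (lker0_lfunVK kg)).
have dimg' (U : {vspace 'rV[R]_3}) :
    \dim U == 1%N -> \dim (g^-1 @: U)%VS == 1%N.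
  by rewrite limg_dim_eq // (eqP kg') capv0.
pose h (p : proj_plane R) : proj_plane R :=
  exist _ (g^-1 @: val p)%VS (dimg' _ (valP p)).
exists h; split.
- by exists (g^-1)%VF.
- by move=> p; apply: val_inj; rewrite /= ef -limg_comp lker0_compVf // lim1g.
- by move=> p; apply: val_inj; rewrite /= ef /= -limg_comp lker0_compfV // lim1g.
Qed.

(* PGL_3(R), as a group of transformations of the projective plane; the
   product is composition. *)
Record pgl (R : realType) := Pgl {
  pgl_fun :> proj_plane R -> proj_plane R;
  _ : `[< proj_linear pgl_fun >] }.

HB.instance Definition _ (R : realType) := [isSub for @pgl_fun R].
HB.instance Definition _ (R : realType) := [Choice of pgl R by <:].

Section PglGroup.
Context (R : realType).
Implicit Types f g : pgl R.

Lemma pglP f : proj_linear f. Proof. exact/asboolP/(valP f). Qed.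

Definition pgl_of (f : proj_plane R -> proj_plane R) (Hf : proj_linear f) :
  pgl R := Pgl (asboolT Hf).

Definition pgl_one := pgl_of (@proj_linear_id R).
Definition pgl_mul f g := pgl_of (proj_linear_comp (pglP f) (pglP g)).
Definition pgl_inv f : pgl R :=
  let: exist h H := cid (proj_linear_inv (pglP f)) in
  let: And3 Hh _ _ := H in pgl_of Hh.

Lemma pgl_mulA : associative pgl_mul.
Proof. by move=> f g h; exact: val_inj. Qed.
Lemma pgl_mul1 : left_id pgl_one pgl_mul.
Proof. by move=> f; exact: val_inj. Qed.
Lemma pgl_mulr1 : right_id pgl_one pgl_mul.
Proof. by move=> f; exact: val_inj. Qed.
Lemma pgl_mulV : left_inverse pgl_one pgl_inv pgl_mul.
Proof.
move=> f; apply: val_inj; rewrite /pgl_inv; case: cid => h [Hh fh hf].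
by apply/funext => p /=; exact: fh.
Qed.
Lemma pgl_mulrV : right_inverse pgl_one pgl_inv pgl_mul.
Proof.
move=> f; apply: val_inj; rewrite /pgl_inv; case: cid => h [Hh fh hf].
by apply/funext => p /=; exact: hf.
Qed.

HB.instance Definition _ := isGroup.Build (pgl R)
  pgl_mulA pgl_mul1 pgl_mulr1 pgl_mulV pgl_mulrV.

End PglGroup.

Definition preserves (R : realType) (X : set (proj_plane R))
    (L : set (set (proj_plane R))) : pred (pgl R) :=
  fun g => `[< g @` X = X /\ [set g @` l | l in L] = L >].

Lemma preserves_group_closed (R : realType) (X : set (proj_plane R))
  (L : set (set (proj_plane R))) : group_closed (preserves X L).
Proof.
have step (g : pgl R) : preserves X L g ->
    g @` X = X /\ [set g @` l | l in L] = L by move=> /asboolP.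
have img1 (A : set (proj_plane R)) : (1%g : pgl R) @` A = A by exact: image_id.
have imgM (g h : pgl R) (A : set (proj_plane R)) :
    (g * h)%g @` A = g @` (h @` A) by rewrite image_comp.
split=> [|g h /step[gX gL] /step[hX hL]].
  by apply/asboolP; split; rewrite // -[RHS]image_id; apply: eq_imagel.
have hVh (A : set (proj_plane R)) : (h^-1)%g @` (h @` A) = A.
  by rewrite -imgM mulVg.
apply/asboolP; split; first by rewrite imgM -[in LHS]hX hVh.
rewrite -[in LHS]hL image_comp -[RHS]gL; apply: eq_imagel => l _ /=.
by rewrite -image_comp hVh.
Qed.

(* The group of projective linear transformations g such that g(X) = X and
   g(L) = L. *)
Record stabilizer (R : realType) (X : set (proj_plane R))
    (L : set (set (proj_plane R))) := Stabilizer {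
  stab_pgl :> pgl R;
  _ : preserves X L stab_pgl }.

HB.instance Definition _ (R : realType) (X : set (proj_plane R))
    (L : set (set (proj_plane R))) := [isSub for @stab_pgl R X L].
HB.instance Definition _ (R : realType) (X : set (proj_plane R))
    (L : set (set (proj_plane R))) := [Choice of stabilizer X L by <:].
HB.instance Definition _ (R : realType) (X : set (proj_plane R))
    (L : set (set (proj_plane R))) :=
  SubChoice_isSubGroup.Build (pgl R) (preserves X L) (stabilizer X L)
    (preserves_group_closed X L).

Definition stab_orbit (R : realType) (X : set (proj_plane R))
    (L : set (set (proj_plane R))) (x : proj_plane R) : set (proj_plane R) :=
  [set g x | g in [set: stabilizer X L]].

Definition isomorphic (G H : groupType) : Prop :=
  exists f : {multiplicative G -> H}, bijective f.

(* Main.v *)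
Require Import Defs.
From HB Require Import structures.
From mathcomp Require Import all_boot all_order all_algebra all_fingroup all_solvable.
From mathcomp Require Import all_classical all_reals all_analysis.
From mathcomp Require Import zify ring lra.

(** The sixteen points and fifteen lines are, up to a projective change of coordinates,
    the configuration of the symmetry axes and planes of a regular icosahedron, that is,
    of the hemi-icosahedron in the projective plane: the centre and the middle ring
    are the six axes through vertices, the inner and outer rings are the ten axes
    through face centres, and the fifteen lines are the joins of the six points
    ([vertices_embed], [faces_embed], [edges_completions]). Concretely, the six points
    have homogeneous coordinates on which a quadratic form has the Gram matrix of
    six equiangular vectors ([six_gram]); the golden ratio enters through the equation
    [turn_cos1_eq] of the cosine of 72 degrees.

    Everything else follows from the Gram matrix. The six points are distinguished
    among all points as those on at least four of the lines ([vertexP]), so the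
    stabilizer acts on them. A collineation permuting the six lines multiplies the Gram
    determinants of triples by products of squared multipliers; a product formula
    forces the multipliers to be equal up to sign ([multiplier_sqr]), so the
    permutation preserves which of the two values the Gram determinant of a triple
    takes: it is an automorphism of a two-graph on six points ([collineation_aut]).
    Conversely an automorphism of the two-graph preserves the Gram matrix up to signs,
    so it comes from a linear map, written down with the tight frame expansion
    ([lift_mxE], [realize]). A collineation fixing the six points is the identity
    ([collineation_id]), so the stabilizer is the automorphism group of the two-graph.

    The rest is finite: that group permutes the five perfect matchings of a
    factorization of the complete graph on the six points, which identifies it with
    the alternating group on five letters ([aut_color], [sigma_even], [sigma_onto],
    [sigma_eq1]), and it is transitive on ordered pairs and on ordered faces
    ([aut_trans2], [aut_trans3]), which gives the orbits on lines and points. *)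

Set Implicit Arguments.
Unset Strict Implicit.
Unset Printing Implicit Defensive.

(** * The two-graph of the six diagonals of the icosahedron *)

(** Vertex 5 is the centre of the pentagon and vertices 0, .., 4 are the cyclically
    ordered points of the middle ring. Unit vectors on six diagonals of an icosahedron
    have inner products 1/sqrt 5 or -1/sqrt 5; here the negative ones are those of
    the non-adjacent pairs of the pentagon. *)
Definition sneg (i j : nat) : bool :=
  [&& i < 5, j < 5 & (i + 4 * j) %% 5 \in [:: 2; 3]].

(** The sign of a product over a triangle is unchanged when a vector of the system is
    replaced by its opposite, so it depends on the six lines alone. *)
Definition tau (i j k : nat) : bool := sneg i j (+) sneg j k (+) sneg i k.

Definition two_graph_aut (s : 'S_6) : Prop :=
  forall i j k : 'I_6, tau (s i) (s j) (s k) = tau i j k.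

(** A factorization of the complete graph on six vertices into five perfect
    matchings: the matching of colour [a] joins 5 to [a], and [a - d] to [a + d]
    modulo 5; 3 is the inverse of 2. *)
Definition duad_color (i j : nat) : nat :=
  if i == 5 then j else if j == 5 then i else (3 * (i + j)) %% 5.

Lemma snegC (i j : nat) : sneg i j = sneg j i.
Proof.
case: (ltnP i 5) => hi; last by rewrite /sneg ltnNge hi /= andbF.
case: (ltnP j 5) => hj; last by rewrite /sneg [j < 5]ltnNge hj /= andbF.
by case: i hi => [|[|[|[|[|//]]]]] _; case: j hj => [|[|[|[|[|//]]]]].
Qed.

Lemma sneg_diag (i : nat) : sneg i i = false.
Proof. by rewrite /sneg -mulSn modnMr !andbF. Qed.

(** The one-line notation of a permutation, on which finite facts about
    permutations are decided by evaluation. *)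
Definition word n (s : 'S_n) : seq nat := [seq (s i : nat) | i <- enum 'I_n].

Lemma nth_word n (s : 'S_n) (i : 'I_n) : nth 0 (word s) i = s i.
Proof. by rewrite (nth_map i) ?size_enum_ord // nth_ord_enum. Qed.

Lemma mem_word n (s : 'S_n) : word s \in permutations (iota 0 n).
Proof.
rewrite mem_permutations -val_enum_ord [word s](map_comp val s); apply: perm_map.
apply: uniq_perm; rewrite ?enum_uniq ?(map_inj_uniq (@perm_inj _ s)) ?enum_uniq //.
by move=> i; rewrite mem_enum -[i](permKV s) (mem_map (@perm_inj _ s)) mem_enum.
Qed.

Lemma wordP n (w : seq nat) : w \in permutations (iota 0 n) ->
  exists s : 'S_n, word s = w.
Proof.
rewrite mem_permutations => pw.
have sw : size w = n by rewrite (perm_size pw) size_iota.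
have lw (i : 'I_n) : nth 0 w i < n.
  have : nth 0 w i \in w by rewrite mem_nth // sw.
  by rewrite (perm_mem pw) mem_iota.
have inj : injective (fun i => Ordinal (lw i)).
  move=> i j [] /eqP; rewrite nth_uniq ?sw // ?(perm_uniq pw) ?iota_uniq //.
  by move=> /eqP/val_inj.
exists (perm inj); apply: (@eq_from_nth _ 0) => [|k].
  by rewrite size_map size_enum_ord.
rewrite size_map size_enum_ord => kn.
by rewrite -[k]/(val (Ordinal kn)) nth_word permE.
Qed.

Lemma word_inj n : injective (@word n).
Proof.
move=> s t st; apply/permP => i; apply: val_inj.
by rewrite /= -!nth_word st.
Qed.

(** Since [tau] is symmetric and vanishes on degenerate triples, it is enough to test
    the decreasing triples. *)
Definition aut_word (w : seq nat) : bool :=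
  all (fun i => all (fun j => all (fun k =>
    tau (nth 0 w i) (nth 0 w j) (nth 0 w k) == tau i j k)
  (iota 0 j)) (iota 0 i)) (iota 0 6).

Definition aut_words : seq (seq nat) :=
  Eval vm_compute in [seq w <- permutations (iota 0 6) | aut_word w].

Lemma aut_wordsE : aut_words = [seq w <- permutations (iota 0 6) | aut_word w].
Proof. by vm_compute. Qed.

Lemma tau_degenerate (i j k : nat) : ~~ [&& i != j, i != k & j != k] ->
  tau i j k = false.
Proof.
rewrite !negb_and !negbK => /or3P[] /eqP ->; rewrite /tau sneg_diag.
- by rewrite addbb.
- by rewrite addbF (snegC j) addbb.
- by rewrite addbF addbb.
Qed.

Lemma tauP (w : seq nat) : aut_word w -> forall i j k : nat,
  i < 6 -> j < 6 -> k < 6 ->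
  tau (nth 0 w i) (nth 0 w j) (nth 0 w k) = tau i j k.
Proof.
have tauC i j k : tau i j k = tau j i k.
  by rewrite /tau (snegC j i); case: (sneg i j); case: (sneg j k); case: (sneg i k).
have tauCr i j k : tau i j k = tau i k j.
  by rewrite /tau (snegC k j); case: (sneg i j); case: (sneg j k); case: (sneg i k).
have tau_diag i k : tau i i k = false by rewrite tau_degenerate ?eqxx.
have tau_diag' i k : tau i k k = false by rewrite tau_degenerate ?eqxx ?andbF.
move=> ok.
have main i j k : k < j -> j < i -> i < 6 ->
    tau (nth 0 w i) (nth 0 w j) (nth 0 w k) = tau i j k.
  move=> kj ji i6; apply/eqP.
  move: ok => /allP /(_ i); rewrite mem_iota => /(_ i6).
  move=> /allP /(_ j); rewrite mem_iota => /(_ ji).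
  by move=> /allP /(_ k); rewrite mem_iota; exact.
move=> i j k i6 j6 k6.
have [ij|ji|->] := ltngtP i j; last by rewrite !tau_diag.
  have [jk|kj|->] := ltngtP j k; last by rewrite !tau_diag'.
    by rewrite tauC [RHS]tauC tauCr [RHS]tauCr tauC [RHS]tauC main.
  have [ik|ki|->] := ltngtP i k; last by rewrite tauCr [RHS]tauCr !tau_diag.
    by rewrite tauC [RHS]tauC tauCr [RHS]tauCr main.
  by rewrite tauC [RHS]tauC main.
have [ik|ki|->] := ltngtP i k; last by rewrite tauCr [RHS]tauCr !tau_diag.
  by rewrite tauCr [RHS]tauCr tauC [RHS]tauC main.
have [jk|kj|->] := ltngtP j k; last by rewrite !tau_diag'.
  by rewrite tauCr [RHS]tauCr main.
by rewrite main.
Qed.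

Lemma mem_aut_words (s : 'S_6) : word s \in aut_words <-> two_graph_aut s.
Proof.
rewrite aut_wordsE mem_filter mem_word andbT; split=> [ok i j k|aut_s].
  by rewrite -!nth_word; apply: tauP.
apply/allP => i; rewrite mem_iota /= add0n => i6.
apply/allP => j; rewrite mem_iota /= add0n => ji.
apply/allP => k; rewrite mem_iota /= add0n => kj.
have j6 := ltn_trans ji i6; have k6 := ltn_trans kj j6.
by have := aut_s (Ordinal i6) (Ordinal j6) (Ordinal k6); rewrite -!nth_word => /eqP.
Qed.

Lemma aut_wordP (w : seq nat) : w \in aut_words ->
  exists2 s : 'S_6, two_graph_aut s & word s = w.
Proof.
move=> wA; have := wA; rewrite aut_wordsE mem_filter => /andP[_ /wordP[s sw]].
by exists s => //; apply/mem_aut_words; rewrite sw.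
Qed.

(** * The action on five perfect matchings *)

Definition emb (a : 'I_5) : 'I_6 := widen_ord (leqnSn 5) a.

Lemma duad_color_lt (i j : 'I_6) : i != j -> duad_color i j < 5.
Proof.
have lt5 (k : 'I_6) : k != 5 :> nat -> k < 5.
  by move=> k5; rewrite ltn_neqAle k5 -ltnS ltn_ord.
move=> ij; rewrite /duad_color; have [i5|/eqP i5] := eqVneq (i : nat) 5.
  by apply: lt5; apply: contraNneq ij => j5; apply/eqP/val_inj; rewrite /= i5 j5.
by have [_|_] := eqVneq (j : nat) 5; [apply/lt5/eqP|rewrite ltn_pmod].
Qed.

Definition color (i j : 'I_6) : 'I_5 := inord (duad_color i j).

Lemma colorE (i j : 'I_6) : i != j -> color i j = duad_color i j :> nat.
Proof. by move=> ij; rewrite inordK // duad_color_lt. Qed.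

Lemma color_inj (i j k : 'I_6) : i != j -> i != k -> color i j = color i k -> j = k.
Proof.
move=> ij ik /(congr1 val) /=; rewrite !colorE // => /eqP eq_c; apply/eqP.
have : all (fun i => all (fun j => all (fun k =>
  [&& i != j, i != k & duad_color i j == duad_color i k] ==> (j == k))
  (iota 0 6)) (iota 0 6)) (iota 0 6) by vm_compute.
move=> /allP /(_ i); rewrite mem_iota => /(_ (ltn_ord i)).
move=> /allP /(_ j); rewrite mem_iota => /(_ (ltn_ord j)).
move=> /allP /(_ k); rewrite mem_iota => /(_ (ltn_ord k)).
by rewrite eq_c andbT; move/implyP; apply; rewrite !(inj_eq val_inj) ij ik.
Qed.

(** The matching of colour [a] is the one containing the pair of 5 and [a], so the
    image of that pair gives the image of the colour. *)
Definition sigma_fun (s : 'S_6) (a : 'I_5) : 'I_5 :=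
  color (s ord_max) (s (emb a)).

Lemma s_max_emb (s : 'S_6) (a : 'I_5) : s ord_max != s (emb a).
Proof.
rewrite (inj_eq perm_inj); apply/eqP => /(congr1 val) /= e.
by have := ltn_ord a; rewrite -e.
Qed.

Lemma sigma_inj (s : 'S_6) : injective (sigma_fun s).
Proof.
move=> a b /color_inj e; have /perm_inj/(congr1 val) := e (s_max_emb s a) (s_max_emb s b).
by move=> ?; apply: val_inj.
Qed.

Definition sigma (s : 'S_6) : 'S_5 := perm (@sigma_inj s).

Definition wsigma (w : seq nat) (a : nat) : nat :=
  duad_color (nth 0 w 5) (nth 0 w a).

Lemma wsigmaE (s : 'S_6) (a : 'I_5) : sigma s a = wsigma (word s) a :> nat.
Proof.
rewrite permE colorE ?s_max_emb // /wsigma -(nth_word s (emb a)).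
by rewrite -(nth_word s ord_max).
Qed.

(** The matchings are determined by the two-graph, so its automorphisms permute
    the five colours. *)
Lemma aut_color (s : 'S_6) : two_graph_aut s -> forall i j : 'I_6, i != j ->
  color (s i) (s j) = sigma s (color i j).
Proof.
move=> /mem_aut_words sA i j ij; apply: val_inj; rewrite /= wsigmaE !colorE //; last first.
  by rewrite (inj_eq perm_inj).
have : all (fun w => all (fun i => all (fun j => (i != j) ==>
  (duad_color (nth 0 w i) (nth 0 w j) == wsigma w (duad_color i j)))
  (iota 0 6)) (iota 0 6)) aut_words by vm_compute.
move=> /allP /(_ _ sA).
move=> /allP /(_ i); rewrite mem_iota => /(_ (ltn_ord i)).
move=> /allP /(_ j); rewrite mem_iota => /(_ (ltn_ord j)).
by rewrite !nth_word (inj_eq val_inj) ij => /eqP.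
Qed.

Lemma sigmaM (s t : 'S_6) : two_graph_aut t -> sigma (s * t)%g = (sigma s * sigma t)%g.
Proof.
move=> aut_t; apply/permP => a; rewrite [LHS]permE permM [sigma s a]permE.
by rewrite /sigma_fun !permM aut_color ?s_max_emb.
Qed.

Lemma sigma_eq1 (s : 'S_6) : two_graph_aut s -> sigma s = 1%g -> s = 1%g.
Proof.
move=> /mem_aut_words sA s1; apply: word_inj.
have -> : word (1 : 'S_6)%g = iota 0 6.
  by rewrite /word -val_enum_ord; apply: eq_map => i; rewrite perm1.
have : all (fun w => all (fun a => wsigma w a == a) (iota 0 5) ==> (w == iota 0 6))
  aut_words by vm_compute.
move=> /allP /(_ _ sA) /implyP h; apply/eqP/h; apply/allP => a.
rewrite mem_iota /= add0n => a5.
by rewrite -(wsigmaE s (Ordinal a5)) s1 perm1.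
Qed.

Definition wcomp (u v : seq nat) : seq nat := [seq nth 0 v x | x <- u].

Lemma wcompE n (s t : 'S_n) : wcomp (word s) (word t) = word (s * t)%g.
Proof.
by rewrite /wcomp -map_comp; apply: eq_map => i; rewrite /= nth_word permM.
Qed.

(** In the alternating group on five letters, elements of odd order are squares and
    double transpositions are products of two squares. *)
Lemma aut_squares (s : 'S_6) : two_graph_aut s ->
  exists t u, [/\ two_graph_aut t, two_graph_aut u & s = (t * t * (u * u))%g].
Proof.
move=> /mem_aut_words sA.
have : let sq := undup [seq wcomp w w | w <- aut_words] in
  all (fun w => has (fun a => has (fun b => w == wcomp a b) sq) sq) aut_words.
  by vm_compute.
move=> /allP /(_ _ sA) /hasP[a]; rewrite mem_undup => /mapP[_ /aut_wordP[t tA <-] ->].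
move=> /hasP[b]; rewrite mem_undup => /mapP[_ /aut_wordP[u uA <-] ->].
by rewrite !wcompE => /eqP/word_inj ->; exists t, u.
Qed.

Lemma sigma_even (s : 'S_6) : two_graph_aut s -> sigma s \in ('Alt_('I_5))%g.
Proof.
move=> /aut_squares[t [u [tA uA ->]]].
have autM s1 s2 : two_graph_aut s1 -> two_graph_aut s2 -> two_graph_aut (s1 * s2)%g.
  by move=> A1 A2 i j k; rewrite !permM A2.
rewrite Alt_even (sigmaM _ (autM _ _ uA uA)) (sigmaM _ tA) (sigmaM _ uA).
by rewrite !odd_permM !addbb.
Qed.

(** Every permutation of five letters is, up to multiplication by one transposition,
    in the image of [sigma]; as that image consists of even permutations, it contains
    every even one. *)
Lemma sigma_onto (u : 'S_5) : u \in ('Alt_('I_5))%g ->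
  exists2 s, two_graph_aut s & sigma s = u.
Proof.
rewrite Alt_even => even_u.
pose a0 : 'I_5 := ord0; pose a1 : 'I_5 := inord 1.
have a1E : a1 = 1 :> nat by rewrite inordK.
pose imgs := [seq [seq wsigma w a | a <- iota 0 5] | w <- aut_words].
have img_sigma (v : 'S_5) : word v \in imgs ->
    exists2 s, two_graph_aut s & sigma s = v.
  move=> /mapP[_ /aut_wordP[s sA <-] vE]; exists s => //.
  apply/permP => a; apply: val_inj.
  by rewrite /= wsigmaE -nth_word vE (nth_map 0) ?size_iota // nth_iota.
have : all (fun w => (w \in imgs) || (wcomp [:: 1; 0; 2; 3; 4] w \in imgs))
  (permutations (iota 0 5)) by vm_compute.
move=> /allP /(_ _ (mem_word u)) /orP[/img_sigma//|].
have -> : [:: 1; 0; 2; 3; 4] = word (tperm a0 a1).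
  apply: (@eq_from_nth _ 0) => [|k]; first by rewrite size_map size_enum_ord.
  rewrite /= => k5; rewrite -[X in _ = nth _ _ X]/(val (Ordinal k5)) nth_word.
  rewrite permE /= -!(inj_eq val_inj) /= a1E.
  by case: k k5 => [|[|[|[|[|//]]]]].
rewrite wcompE => /img_sigma[s /sigma_even sA su]; move: sA.
by rewrite su Alt_even odd_permM odd_tperm -(inj_eq val_inj) /= a1E (negbTE even_u).
Qed.

(** * Transitivity *)

Lemma aut_trans2 (i j : 'I_6) : i != j ->
  exists2 s, two_graph_aut s & s ord_max = i /\ s ord0 = j.
Proof.
move=> ij.
have : all (fun i => all (fun j => (i != j) ==>
    has (fun w => (nth 0 w 5 == i) && (nth 0 w 0 == j)) aut_words)
  (iota 0 6)) (iota 0 6) by vm_compute.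
move=> /allP /(_ i); rewrite mem_iota => /(_ (ltn_ord i)).
move=> /allP /(_ j); rewrite mem_iota => /(_ (ltn_ord j)).
rewrite (inj_eq val_inj) ij => /hasP[_ /aut_wordP[s sA <-]].
have /= -> := nth_word s ord_max; have /= -> := nth_word s ord0.
by move=> /andP[/eqP/val_inj <- /eqP/val_inj <-]; exists s.
Qed.

Lemma aut_trans3 (i j k : 'I_6) : i != j -> i != k -> j != k -> ~~ tau i j k ->
  exists2 s, two_graph_aut s & [/\ s ord_max = i, s ord0 = j & s (inord 1) = k].
Proof.
move=> ij ik jk tijk.
have : all (fun i => all (fun j => all (fun k =>
    [&& i != j, i != k, j != k & ~~ tau i j k] ==>
    has (fun w => [&& nth 0 w 5 == i, nth 0 w 0 == j & nth 0 w 1 == k]) aut_words)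
  (iota 0 6)) (iota 0 6)) (iota 0 6) by vm_compute.
move=> /allP /(_ i); rewrite mem_iota => /(_ (ltn_ord i)).
move=> /allP /(_ j); rewrite mem_iota => /(_ (ltn_ord j)).
move=> /allP /(_ k); rewrite mem_iota => /(_ (ltn_ord k)).
rewrite !(inj_eq val_inj) ij ik jk tijk => /hasP[_ /aut_wordP[s sA <-]].
have /= -> := nth_word s ord_max; have /= -> := nth_word s ord0.
have := nth_word s (inord 1); rewrite inordK // => ->.
by move=> /and3P[/eqP/val_inj <- /eqP/val_inj <- /eqP/val_inj <-]; exists s.
Qed.

(** The ten triples of distinct vertices on which [tau] vanishes consist of a pair of
    adjacent vertices of the pentagon 0, .., 4, joined either to 5 or to the opposite
    vertex; they are listed in all the orders that an increasing triple can have. *)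
Definition face_word (m : nat) (w : seq nat) : bool :=
  let a := (m + 2) %% 5 in let b := (m + 3) %% 5 in
  w \in [:: [:: a; b; 5]; [:: b; a; 5]; [:: a; b; m]; [:: b; a; m];
            [:: a; m; b]; [:: b; m; a]; [:: m; a; b]; [:: m; b; a]].

Lemma sorted_face_word (i j k : 'I_6) : i < j -> j < k -> ~~ tau i j k ->
  exists2 m, m < 5 & face_word m [:: nat_of_ord i; nat_of_ord j; nat_of_ord k].
Proof.
move=> ij jk t.
have : all (fun i => all (fun j => all (fun k => [&& i < j, j < k & ~~ tau i j k] ==>
    has (fun m => face_word m [:: i; j; k]) (iota 0 5))
  (iota 0 6)) (iota 0 6)) (iota 0 6) by vm_compute.
move=> /allP /(_ i); rewrite mem_iota => /(_ (ltn_ord i)).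
move=> /allP /(_ j); rewrite mem_iota => /(_ (ltn_ord j)).
move=> /allP /(_ k); rewrite mem_iota => /(_ (ltn_ord k)).
rewrite ij jk t => /hasP[m]; rewrite mem_iota => m5; by exists m.
Qed.

Import Order.TTheory GRing.Theory Num.Theory.
Local Open Scope classical_set_scope.
Local Open Scope card_scope.
Local Open Scope ring_scope.

(** * Six equiangular lines *)

Lemma det_mx33 (F : comRingType) (A : 'M[F]_3) (i0 := ord0) (i1 := inord 1)
    (i2 := ord_max) :
  \det A = A i0 i0 * (A i1 i1 * A i2 i2 - A i1 i2 * A i2 i1)
         - A i0 i1 * (A i1 i0 * A i2 i2 - A i1 i2 * A i2 i0)
         + A i0 i2 * (A i1 i0 * A i2 i1 - A i1 i1 * A i2 i0).
Proof.
have e1 : lift ord0 ord0 = i1 by apply: val_inj; rewrite /= inordK.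
have e2 : lift ord0 (lift ord0 ord0) = i2 by apply: val_inj.
rewrite (expand_det_row A ord0) !big_ord_recl big_ord0 /cofactor.
rewrite !(expand_det_row _ ord0) !big_ord_recl !big_ord0 /cofactor !det_mx11 !mxE.
rewrite -[lift i0 (lift ord0 ord0)]/(lift ord0 (lift ord0 ord0)) /= e2 e1.
have -> : lift i1 (lift ord0 ord0 : 'I_2) = i2.
  by apply: val_inj; rewrite /= /bump inordK.
have -> : lift i2 (lift ord0 ord0 : 'I_2) = i1.
  by apply: val_inj; rewrite /= /bump inordK.
have -> : lift (lift ord0 ord0 : 'I_2) 0 = ord0 by apply: val_inj.
have -> : lift i1 (ord0 : 'I_2) = i0 by apply: val_inj; rewrite /= /bump inordK.
have -> : lift i2 (ord0 : 'I_2) = i0 by apply: val_inj.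
rewrite e1 /bump /=.
by rewrite ?(expr0, expr1, expr2, addn0, mul1r); ring.
Qed.

Section Equiangular.
Context (R : realType).

Local Notation s5 := (Num.sqrt (5 : R)).

Definition sgn (i j : nat) : R := (-1) ^+ sneg i j.

(** Six vectors of squared norm 5 on equiangular lines. *)
Definition gram (i j : nat) : R := if i == j then 5 else s5 * sgn i j.

Lemma sqr_s5 : s5 ^+ 2 = 5. Proof. by rewrite sqr_sqrtr. Qed.

Lemma s5_gt2 : 2 < s5.
Proof.
have : 0 <= s5 by rewrite sqrtr_ge0.
by have := sqr_s5; nra.
Qed.

(** The Gram determinant of three of the six vectors. *)
Definition volume2 (i j k : nat) : R := 50 + 10 * s5 * (-1) ^+ tau i j k.

Lemma volume2_gt0 (i j k : nat) : 0 < volume2 i j k.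
Proof.
have s0 := s5_gt2; have s2 := sqr_s5.
by rewrite /volume2; case: tau; rewrite ?expr0 ?expr1; nra.
Qed.

Lemma sgnC (i j : nat) : sgn i j = sgn j i.
Proof. by rewrite /sgn snegC. Qed.

Lemma sgn_neq0 (i j : nat) : sgn i j != 0.
Proof. by rewrite signr_eq0. Qed.

(** The conference matrix of the signs squares to a multiple of the identity, so
    the six vectors form a tight frame. *)
Lemma gram_sqr (i k : 'I_6) : \sum_(j < 6) gram i j * gram j k = 10 * gram i k.
Proof.
have s2 := sqr_s5.
by case: i => -[|[|[|[|[|[|//]]]]]] hi; case: k => -[|[|[|[|[|[|//]]]]]] hk;
  rewrite !big_ord_recr big_ord0 /gram /sgn /sneg /= ?expr0 ?expr1; nra.
Qed.

Context (Y : 'I_6 -> 'rV[R]_3) (Q : 'M[R]_3).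
Hypothesis gramY : forall i j, Y i *m Q *m (Y j)^T = (gram i j)%:M.

Definition frame (f : 'I_3 -> 'I_6) : 'M[R]_3 := \matrix_a Y (f a).

Definition triple (i j k : 'I_6) (a : 'I_3) : 'I_6 := tnth [tuple i; j; k] a.

Lemma row_frame f a : row a (frame f) = Y (f a).
Proof. by rewrite rowK. Qed.

(** The product of the three off-diagonal entries is the only term of the determinant
    that sees the signs, and it sees them through [tau]. *)
Lemma det_frame (i j k : 'I_6) : i != j -> i != k -> j != k ->
  \det (frame (triple i j k)) ^+ 2 * \det Q = volume2 i j k.
Proof.
move=> ij ik jk; set f := triple i j k.
have gramE : frame f *m Q *m (frame f)^T = \matrix_(a, b) gram (f a) (f b).
  apply/row_matrixP => a; apply/rowP => b.
  rewrite !row_mul row_frame !mxE.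
  transitivity ((Y (f a) *m Q *m (Y (f b))^T) 0 0).
    by rewrite [RHS]mxE; apply: eq_bigr => c _; rewrite !mxE.
  by rewrite gramY mxE eqxx.
have -> : \det (frame f) ^+ 2 * \det Q = \det (frame f *m Q *m (frame f)^T).
  by rewrite !det_mulmx det_tr; ring.
rewrite gramE det_mx33 !mxE.
have -> : f ord0 = i by [].
have -> : f (inord 1) = j by rewrite /f /triple (tnth_nth i) inordK.
have -> : f ord_max = k by [].
have s2 := sqr_s5; have s4 : s5 ^+ 3 = 5 * s5 by rewrite exprS s2 mulrC.
rewrite /gram !eqxx !(inj_eq val_inj) !(negbTE ij, negbTE ik, negbTE jk, eq_sym j i).
rewrite !(eq_sym k) (negbTE ik) (negbTE jk) (sgnC j i) (sgnC k i) (sgnC k j).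
rewrite /volume2 /tau /sgn.
by case: sneg; case: sneg; case: sneg; rewrite /= ?expr0 ?expr1; nra.
Qed.

Lemma unit_frame (i j k : 'I_6) : i != j -> i != k -> j != k ->
  frame (triple i j k) \in unitmx.
Proof.
move=> ij ik jk; rewrite unitmxE unitfE; apply/eqP => d0.
have := det_frame ij ik jk; rewrite d0 expr0n mul0r => /eqP.
by rewrite lt_eqF ?volume2_gt0.
Qed.

Lemma unit_form : Q \in unitmx.
Proof.
have h01 : ord0 != inord 1 :> 'I_6 by rewrite -(inj_eq val_inj) /= inordK.
have h05 : ord0 != ord_max :> 'I_6 by [].
have h15 : inord 1 != ord_max :> 'I_6 by rewrite -(inj_eq val_inj) /= inordK.
rewrite unitmxE unitfE; apply/eqP => d0.
have := det_frame h01 h05 h15; rewrite d0 mulr0 => /eqP.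
by rewrite lt_eqF ?volume2_gt0.
Qed.

Lemma Y_indep (i j k : 'I_6) (a b c : R) : i != j -> i != k -> j != k ->
  a *: Y i + b *: Y j + c *: Y k = 0 -> [/\ a = 0, b = 0 & c = 0].
Proof.
move=> ij ik jk eq0; pose u : 'rV[R]_3 := \row_t tnth [tuple a; b; c] t.
have u0 : u = 0.
  rewrite -[u](mulmxK (unit_frame ij ik jk)) -[RHS](mul0mx _ (invmx (frame (triple i j k)))).
  congr (_ *m _); rewrite -[RHS]eq0.
  rewrite mulmx_sum_row !big_ord_recl big_ord0 addr0 !row_frame !mxE.
  by rewrite addrA; do !congr (_ + _); rewrite /triple !(tnth_nth 0, tnth_nth i).
have uE t : tnth [tuple a; b; c] t = 0 by have /rowP/(_ t) := u0; rewrite !mxE.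
by split; [exact: (uE ord0)|have := uE (inord 1)|exact: (uE ord_max)];
  rewrite (tnth_nth 0) inordK.
Qed.

Lemma Y_neq0 i : Y i != 0.
Proof.
apply/eqP => Yi; have := gramY i i; rewrite Yi !mul0mx => /matrixP/(_ 0 0).
by rewrite /gram !mxE !eqxx => /eqP; rewrite eq_sym mulr1n pnatr_eq0.
Qed.
End Equiangular.

(** * Linear maps permuting the six lines *)

(** Each pair of vertices lies in two triples of either kind. *)
Lemma card_tau (i j : 'I_6) : i != j ->
  #|[pred k : 'I_6 | (k != i) && (k != j) && tau i j k]| = 2%N /\
  #|[pred k : 'I_6 | (k != i) && (k != j) && ~~ tau i j k]| = 2%N.
Proof.
move=> ij.
have count_card (a : pred nat) (b : pred 'I_6) :
    (forall k : 'I_6, b k = a k) -> #|b| = count a (iota 0 6).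
  move=> ab; rewrite -val_enum_ord count_map enumT cardE size_filter.
  by apply: eq_count => k; rewrite /= -ab.
have : all (fun i => all (fun j => (i != j) ==>
    (count (fun k => (k != i) && (k != j) && tau i j k) (iota 0 6) == 2%N) &&
    (count (fun k => (k != i) && (k != j) && ~~ tau i j k) (iota 0 6) == 2%N))
  (iota 0 6)) (iota 0 6) by vm_compute.
move=> /allP /(_ i); rewrite mem_iota => /(_ (ltn_ord i)).
move=> /allP /(_ j); rewrite mem_iota => /(_ (ltn_ord j)).
rewrite (inj_eq val_inj) ij => /andP[/eqP e1 /eqP e2].
by split; [rewrite -[RHS]e1|rewrite -[RHS]e2]; apply: count_card.
Qed.

Lemma exists_third (i j : 'I_6) : i != j -> exists2 k, i != k & j != k.
Proof.
move=> ij; have /card_gt0P[k] :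
    (0 < #|[pred k : 'I_6 | (k != i) && (k != j) && tau i j k]|)%N.
  by have [-> _] := card_tau ij.
by rewrite inE => /andP[/andP[ki kj] _]; exists k; rewrite eq_sym.
Qed.

Section Collineation.
Context (R : realType) (Y : 'I_6 -> 'rV[R]_3) (Q : 'M[R]_3).
Hypothesis gramY : forall i j, Y i *m Q *m (Y j)^T = (gram R i j)%:M.

Lemma prod_volume2 (i j : 'I_6) : i != j ->
  \prod_(k | (k != i) && (k != j)) volume2 R i j k =
  (50 - 10 * Num.sqrt 5) ^+ 2 * (50 + 10 * Num.sqrt 5) ^+ 2.
Proof.
move=> ij; have [c1 c2] := card_tau ij.
rewrite (bigID (fun k : 'I_6 => tau i j k)) /=; congr (_ * _).
  rewrite (eq_bigr (fun=> 50 - 10 * Num.sqrt 5)) => [|k /andP[_ t]].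
    by rewrite prodr_const c1.
  by rewrite /volume2 t mulrN1.
rewrite (eq_bigr (fun=> 50 + 10 * Num.sqrt 5)) => [|k /andP[_ t]].
  by rewrite prodr_const c2.
by rewrite /volume2 (negbTE t) mulr1.
Qed.

Section Permuting.
Context (M : 'M[R]_3) (s : 'S_6) (c : 'I_6 -> R).
Hypothesis YM : forall i, Y i *m M = c i *: Y (s i).

Lemma det_frameM (i j k : 'I_6) :
  \det (frame Y (triple i j k)) * \det M =
  c i * c j * c k * \det (frame Y (triple (s i) (s j) (s k))).
Proof.
have e1 : triple i j k (inord 1) = j by rewrite /triple (tnth_nth i) inordK.
have -> : c i * c j * c k = \det (diag_mx (\row_a c (triple i j k a))).
  rewrite det_diag !big_ord_recl big_ord0 mulr1 !mxE mulrA.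
  by congr (_ * _ * _); rewrite /triple (tnth_nth i).
rewrite -!det_mulmx; congr (\det _); apply/row_matrixP => a.
rewrite !row_mul row_frame YM row_diag_mx -scalemxAl -rowE row_frame mxE.
by congr (_ *: Y _); rewrite /triple !(tnth_nth i); case: a => -[|[|[|//]]].
Qed.

Lemma volume2M (i j k : 'I_6) : i != j -> i != k -> j != k ->
  volume2 R i j k * \det M ^+ 2 =
  (c i * c j * c k) ^+ 2 * volume2 R (s i) (s j) (s k).
Proof.
move=> ij ik jk; rewrite -(det_frame gramY ij ik jk).
rewrite -(@det_frame _ _ _ gramY (s i)) ?(inj_eq perm_inj) //.
by rewrite mulrAC -exprMn det_frameM; ring.
Qed.

Hypothesis c_neq0 : forall i, c i != 0.

(** The product of the identities [volume2M] over all triples containing a given pair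
    has the same volumes on both sides, so [c i ^+ 2 * c j ^+ 2] does not
    depend on the pair. *)
Lemma multiplier_sqr (i j : 'I_6) : c i ^+ 2 = c j ^+ 2.
Proof.
have pair_const (a b : 'I_6) : a != b ->
    ((c a * c b) ^+ 2) ^+ 3 * \prod_k c k ^+ 2 = (\det M ^+ 2) ^+ 4.
  move=> ab.
  have c4 : #|[pred k : 'I_6 | (k != a) && (k != b)]| = 4%N.
    rewrite -[LHS](cardID (fun k : 'I_6 => tau a b k)) /=.
    have [c1 c2] := card_tau ab; rewrite -[RHS]/(2 + 2)%N.
    by congr (_ + _)%N; [rewrite -[RHS]c1|rewrite -[RHS]c2];
      apply: eq_card => k; rewrite !inE // andbC.
  have : \prod_(k | (k != a) && (k != b)) (volume2 R a b k * \det M ^+ 2) =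
      \prod_(k | (k != a) && (k != b))
        (((c a * c b) ^+ 2 * c k ^+ 2) * volume2 R (s a) (s b) (s k)).
    apply: eq_bigr => k /andP[ka kb]; rewrite -exprMn -volume2M //.
    - by rewrite eq_sym.
    - by rewrite eq_sym.
  rewrite big_split /= prodr_const c4 [RHS]big_split /= [in RHS]big_split /= prodr_const c4.
  have -> : \prod_(k | (k != a) && (k != b)) volume2 R (s a) (s b) (s k) =
      \prod_(k | (k != a) && (k != b)) volume2 R a b k.
    rewrite [RHS]prod_volume2 // -(@prod_volume2 (s a) (s b)) ?(inj_eq perm_inj) //.
    rewrite [RHS](reindex_inj (@perm_inj _ s)) /=.
    by apply: eq_bigl => k; rewrite !(inj_eq perm_inj).
  rewrite mulrC => /mulIf ->; last first.
    by apply/prodf_neq0 => k _; rewrite gt_eqF ?volume2_gt0.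
  rewrite [\prod_k _](bigD1 a) //= (bigD1 b) 1?eq_sym //=.
  by rewrite exprMn; ring.
have [<-//|ij] := eqVneq i j.
have [k ik jk] := exists_third ij.
have P0 : \prod_l c l ^+ 2 != 0 by apply/prodf_neq0 => l _; rewrite expf_neq0.
have /(mulIf P0)/eqP := etrans (pair_const i k ik) (esym (pair_const j k jk)).
rewrite eqrXn2 ?sqr_ge0 // => /eqP.
by rewrite !exprMn => /mulIf -> //; rewrite expf_neq0.
Qed.

(** By [multiplier_sqr] the matrix scales all squared volumes by the same factor; as
    these take two values only, it fixes each of them. *)
Lemma collineation_aut : two_graph_aut s.
Proof.
have s0 := s5_gt2 R.
pose g : R := (c ord0 * c ord0 * c ord0) ^+ 2; pose d : R := \det M ^+ 2.
have cg (i j k : 'I_6) : (c i * c j * c k) ^+ 2 = g.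
  by rewrite /g !exprMn (multiplier_sqr i ord0) (multiplier_sqr j ord0)
    (multiplier_sqr k ord0).
have volM (i j k : 'I_6) : i != j -> i != k -> j != k ->
    volume2 R i j k * d = g * volume2 R (s i) (s j) (s k).
  by move=> ij ik jk; rewrite volume2M // cg.
have g_gt0 : 0 < g by rewrite exprn_even_gt0 //= !mulf_neq0.
have d_ge0 : 0 <= d by rewrite sqr_ge0.
move=> i j k.
have [/and3P[ij ik jk]|deg] := boolP [&& i != j, i != k & j != k]; last first.
  by rewrite !tau_degenerate ?(inj_eq val_inj) ?(inj_eq perm_inj).
have n50 : ord_max != ord0 :> 'I_6 by [].
have n51 : ord_max != inord 1 :> 'I_6 by rewrite -(inj_eq val_inj) /= inordK.
have n52 : ord_max != inord 2 :> 'I_6 by rewrite -(inj_eq val_inj) /= inordK.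
have n01 : ord0 != inord 1 :> 'I_6 by rewrite -(inj_eq val_inj) /= inordK.
have n02 : ord0 != inord 2 :> 'I_6 by rewrite -(inj_eq val_inj) /= inordK.
have dg : d = g.
  have := volM _ _ _ n50 n51 n01; have := volM _ _ _ n50 n52 n02.
  rewrite /volume2 !inordK //.
  have -> : tau (@ord_max 5) (@ord0 5) 1 = false by [].
  have -> : tau (@ord_max 5) (@ord0 5) 2 = true by [].
  rewrite expr0 expr1 => vm vp; have V0 : 0 < 50 - 10 * Num.sqrt 5 :> R.
    by have := sqr_s5 R; nra.
  apply/eqP; rewrite eq_le; apply/andP; split.
    rewrite -(@ler_pM2l _ (50 + 10 * Num.sqrt 5 * 1)); last by lra.
    rewrite vp [leRHS]mulrC ler_pM2l //.
    by case: tau; rewrite ?expr0 ?expr1; lra.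
  rewrite -(@ler_pM2l _ (50 + 10 * Num.sqrt 5 * -1)); last by lra.
  rewrite vm [leLHS]mulrC ler_pM2l //.
  by case: tau; rewrite ?expr0 ?expr1; lra.
have := volM _ _ _ ij ik jk; rewrite dg mulrC => /mulfI; rewrite gt_eqF // => /(_ isT).
by rewrite /volume2; case: (tau i j k); case: tau; rewrite ?expr0 ?expr1 // => e;
  exfalso; lra.
Qed.

(** If all six lines are fixed, any three of the six eigenvalues have the same product,
    the determinant, so they all coincide. *)
Lemma collineation_id : s = 1%g -> exists a, M = a%:M.
Proof.
move=> s1; have YM1 i : Y i *m M = c i *: Y i by rewrite YM s1 perm1.
have det_c (i j k : 'I_6) : i != j -> i != k -> j != k -> c i * c j * c k = \det M.
  move=> ij ik jk; have := det_frameM i j k; rewrite s1 !perm1 mulrC => /mulIf -> //.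
  by have := unit_frame gramY ij ik jk; rewrite unitmxE unitfE.
have c_const i : c i = c ord_max.
  have [->//|i5] := eqVneq i ord_max; have [t1 t2] := card_tau i5.
  have /card_gt0P[k] : (0 < #|[pred k : 'I_6 | (k != i) && (k != ord_max)
    && tau i (@ord_max 5) k]|)%N by rewrite t1.
  have /card_gt0P[l] : (0 < #|[pred k : 'I_6 | (k != i) && (k != ord_max)
    && ~~ tau i (@ord_max 5) k]|)%N by rewrite t2.
  rewrite !inE => /andP[/andP[li l5] tl] /andP[/andP[ki k5] tk].
  have kl : k != l by apply: contraTneq tk => ->.
  have ck0 : c k * c l != 0 by rewrite mulf_neq0.
  apply: (mulIf ck0).
  by rewrite !mulrA !det_c // eq_sym.
have n50 : ord_max != ord0 :> 'I_6 by [].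
have n51 : ord_max != inord 1 :> 'I_6 by rewrite -(inj_eq val_inj) /= inordK.
have n01 : ord0 != inord 1 :> 'I_6 by rewrite -(inj_eq val_inj) /= inordK.
exists (c ord_max).
rewrite -[M](mulKmx (unit_frame gramY n50 n51 n01)); apply: canLR.
  exact: (mulKmx (unit_frame gramY n50 n51 n01)).
apply/row_matrixP => a; rewrite !row_mul row_frame YM1 c_const.
by rewrite mul_mx_scalar.
Qed.
End Permuting.

Section Realization.
Context (s : 'S_6).
Hypothesis aut_s : two_graph_aut s.

(** The signs making [i |-> lift_sign i * Y (s i)] a family with the same Gram matrix
    as [Y]; they are normalized at the vertex 5. *)
Definition lift_sign (i : 'I_6) : R :=
  sgn R (@ord_max 5) i * sgn R (s ord_max) (s i).

Lemma lift_sign_neq0 i : lift_sign i != 0.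
Proof. by rewrite mulf_neq0 ?sgn_neq0. Qed.

Lemma sgn_aut (i j : 'I_6) :
  lift_sign j * sgn R i j = lift_sign i * sgn R (s i) (s j).
Proof.
have := aut_s ord_max i j.
rewrite /tau /lift_sign /sgn; case: sneg; case: sneg; case: sneg; case: sneg;
  case: sneg; case: sneg => //= _; rewrite ?expr0 ?expr1; ring.
Qed.

Lemma gram_aut (i j : 'I_6) :
  lift_sign j * gram R i j = lift_sign i * gram R (s i) (s j).
Proof.
rewrite /gram !(inj_eq val_inj) (inj_eq perm_inj); case: eqP => [->//|_].
by rewrite mulrCA sgn_aut mulrCA.
Qed.

(** Both sides have the same products with all the vectors [Y k], which span. *)
Lemma tight_frame (j : 'I_6) : \sum_(i < 6) gram R j i *: Y i = 10 *: Y j.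
Proof.
have n50 : ord_max != ord0 :> 'I_6 by [].
have n51 : ord_max != inord 1 :> 'I_6 by rewrite -(inj_eq val_inj) /= inordK.
have n01 : ord0 != inord 1 :> 'I_6 by rewrite -(inj_eq val_inj) /= inordK.
have uF := unit_frame gramY n50 n51 n01.
suff eqQ k : (\sum_(i < 6) gram R j i *: Y i) *m Q *m (Y k)^T
    = (10 *: Y j) *m Q *m (Y k)^T.
  apply: (can_inj (mulmxK (unit_form gramY))).
  have := mulmxK (_ : (frame Y (triple ord_max ord0 (inord 1)))^T \in unitmx).
  rewrite unitmx_tr => /(_ _ uF) /can_inj; apply.
  apply: trmx_inj; rewrite ![(_ *m _^T)^T]trmx_mul trmxK.
  apply/row_matrixP => a; rewrite !row_mul row_frame.
  by apply: trmx_inj; rewrite ![(Y _ *m _)^T]trmx_mul !trmxK eqQ.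
rewrite !mulmx_suml -!scalemxAl gramY.
under eq_bigr => i _ do rewrite -!scalemxAl gramY scale_scalar_mx.
by rewrite -raddf_sum gram_sqr scale_scalar_mx.
Qed.

Definition lift_mx : 'M[R]_3 := \sum_i lift_sign i *: (Q *m (Y i)^T *m Y (s i)).

(** An automorphism of the two-graph preserves the Gram matrix up to the signs
    [lift_sign], so the tight frame expansion of a vector is carried to that of its
    image. *)
Lemma lift_mxE (j : 'I_6) : Y j *m lift_mx = (10 * lift_sign j) *: Y (s j).
Proof.
rewrite mulrC -scalerA -tight_frame scaler_sumr mulmx_sumr.
rewrite [RHS](reindex_inj (@perm_inj _ s)); apply: eq_bigr => i _.
rewrite -scalemxAr !mulmxA gramY mul_scalar_mx !scalerA gram_aut //.
Qed.
End Realization.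
End Collineation.

(** * Points, lines and collineations in homogeneous coordinates *)

Section Homogeneous.
Context (R : realType).
Implicit Types (u v w : 'rV[R]_3) (M : 'M[R]_3) (p : proj_plane R).

(** The point of coordinates [u]; the zero vector gives a junk point. *)
Definition pt u : proj_plane R := insubd (embed (0, 0)) <[u]>%VS.

Definition pln u v : set (proj_plane R) := [set p | (val p <= <[u]> + <[v]>)%VS].

Lemma val_pt u : u != 0 -> val (pt u) = <[u]>%VS.
Proof. by move=> u0; rewrite val_insubd dim_vline u0. Qed.

Lemma pt_exists p : exists2 u, u != 0 & p = pt u.
Proof.
have dp : \dim (val p) == 1%N := valP p.
have p0 : val p != 0%VS by rewrite -dimv_eq0 (eqP dp).
exists (vpick (val p)); first by rewrite vpick0.
apply: val_inj; rewrite val_pt ?vpick0 //; apply/eqP.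
by rewrite eq_sym eqEdim -memvE memv_pick /= dim_vline vpick0 p0 (eqP dp).
Qed.

Lemma pt_scale a u : a != 0 -> u != 0 -> pt (a *: u) = pt u.
Proof.
move=> a0 u0; apply: val_inj; rewrite !val_pt ?scaler_eq0 ?negb_or ?a0 //.
apply/eqP; rewrite eqEdim !dim_vline scaler_eq0 negb_or a0 u0 andbT.
by rewrite -memvE memvZ ?memv_line.
Qed.

Lemma pt_eq u v : u != 0 -> v != 0 -> pt u = pt v ->
  exists2 a, a != 0 & u = a *: v.
Proof.
move=> u0 v0 /(congr1 val); rewrite !val_pt // => uv.
have /vlineP[a ua] : u \in <[v]>%VS by rewrite -uv memv_line.
by exists a => //; apply: contra_neq u0 => a0; rewrite ua a0 scale0r.
Qed.

Lemma plnP u v w : w != 0 -> pln u v (pt w) <-> exists a b, w = a *: u + b *: v.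
Proof.
move=> w0; rewrite /pln /= val_pt // -memvE; split.
  by move=> /memv_addP[_ /vlineP[a ->] [_ /vlineP[b ->] ->]]; exists a, b.
move=> [a [b ->]]; apply/memv_addP; exists (a *: u); first by rewrite memvZ ?memv_line.
by exists (b *: v); rewrite ?memvZ ?memv_line.
Qed.

Lemma plnC u v : pln u v = pln v u.
Proof. by rewrite /pln addvC. Qed.

Definition rmul M : 'End('rV[R]_3) := linfun (mulmxr M).

Lemma rmulE M u : rmul M u = u *m M. Proof. by rewrite lfunE. Qed.

Lemma lker_rmul M : M \in unitmx -> lker (rmul M) == 0%VS.
Proof.
by move=> uM; apply/lker0P => u v; rewrite !rmulE; apply: (can_inj (mulmxK uM)).
Qed.

Definition represents M (g : pgl R) : Prop :=
  M \in unitmx /\ forall p, val (g p) = (rmul M @: val p)%VS.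

Lemma represents_pt M g u : represents M g -> u != 0 -> g (pt u) = pt (u *m M).
Proof.
move=> [uM gM] u0; apply: val_inj; rewrite gM !val_pt //.
  by rewrite limg_line rmulE.
by apply: contra_neq u0 => uM0; rewrite -(mulmxK uM u) uM0 mul0mx.
Qed.

Lemma represents_ex (g : pgl R) : exists M, represents M g.
Proof.
have [e ke ge] := pglP g; exists (lin1_mx e).
have eE : rmul (lin1_mx e) = e.
  by apply/lfunP => u; rewrite rmulE mul_rV_lin1.
split; last by rewrite eE.
rewrite -row_free_unit; apply/row_freeP.
exists (lin1_mx (e^-1)%VF); apply/row_matrixP => i.
rewrite row_mul !rowE mulmx1 !mul_rV_lin1 /= lker0_lfunK //.
Qed.

Lemma represents_pgl M : M \in unitmx -> exists g, represents M g.
Proof.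
move=> uM; have ke := lker_rmul uM.
have dimg (U : {vspace 'rV[R]_3}) :
    \dim U == 1%N -> \dim (rmul M @: U)%VS == 1%N.
  by rewrite limg_dim_eq // (eqP ke) capv0.
pose f p : proj_plane R := exist _ (rmul M @: val p)%VS (dimg _ (valP p)).
have fM : proj_linear f by exists (rmul M).
by exists (pgl_of fM).
Qed.

Lemma represents_pln M g u v : represents M g ->
  g @` pln u v = pln (u *m M) (v *m M).
Proof.
move=> [uM gM]; have ke := lker_rmul uM.
have plnE : (<[u *m M]> + <[v *m M]> = rmul M @: (<[u]> + <[v]>))%VS.
  by rewrite limgD !limg_line !rmulE.
apply/seteqP; split=> [_ [p pu <-]|p]; rewrite /pln /= plnE.
  by rewrite gM limgS.
move=> pe; exists (g^-1 p)%g; last first.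
  by rewrite -[LHS]/((g * g^-1)%g p) mulgV.
by rewrite /pln /= -(limg_ker0 _ _ ke) -gM -[X in val X]/((g * g^-1)%g p) mulgV.
Qed.

Lemma represents_scalar a g : represents a%:M g -> g = 1%g.
Proof.
move=> gM; have [uM _] := gM.
have a0 : a != 0 by move: uM; rewrite unitmxE det_scalar unitfE expf_eq0.
have gE p : g p = p.
  by have [u u0 ->] := pt_exists p; rewrite (represents_pt gM) // mul_mx_scalar pt_scale.
by apply: val_inj; apply/funext.
Qed.
End Homogeneous.

(** * The hemi-icosahedron *)

Lemma card_image_fin (T : finType) (U : Type) (f : T -> U) (D : {pred T}) :
  {in D &, injective f} -> f @` [set x | x \in D] #= `I_#|D|.
Proof.
move=> f_inj.
have D_I : [set x | x \in D] #= `I_#|D|.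
  have -> : `I_#|D| = (fun x => index x (enum D)) @` [set x | x \in D].
    apply/seteqP; split=> [k /= kD|_ [x /= xD <-]]; last first.
      by rewrite /= cardE index_mem mem_enum.
    have /card_gt0P[x0 _] : (0 < #|D|)%N by apply: leq_ltn_trans kD.
    rewrite cardE in kD; exists (nth x0 (enum D) k); last by rewrite index_uniq ?enum_uniq.
    by rewrite /= -mem_enum mem_nth.
  rewrite card_eq_sym; apply: inj_card_eq => x y; rewrite !inE /= => xD yD.
  move=> /(congr1 (nth x (enum D))).
  by rewrite !nth_index ?mem_enum.
by apply: card_eq_trans D_I; apply: inj_card_eq => x y; rewrite !inE; apply: f_inj.
Qed.

Section HemiIcosahedron.
Context (R : realType) (Y : 'I_6 -> 'rV[R]_3) (Q : 'M[R]_3).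
Hypothesis gramY : forall i j, Y i *m Q *m (Y j)^T = (gram R i j)%:M.

Local Notation s5 := (Num.sqrt (5 : R)).

Definition vertex (i : 'I_6) : proj_plane R := pt (Y i).
Definition edge (i j : 'I_6) : set (proj_plane R) := pln (Y i) (Y j).
(** When [tau i j k] vanishes, the signs make the products of the three vectors positive,
    and their sum is on the axis through the centre of a face of the icosahedron. *)
Definition face_vec (i j k : 'I_6) : 'rV[R]_3 :=
  Y i + sgn R i j *: Y j + sgn R i k *: Y k.
Definition face (i j k : 'I_6) : proj_plane R := pt (face_vec i j k).

Definition is_face (i j k : 'I_6) : bool :=
  [&& i != j, i != k, j != k & ~~ tau i j k].

Definition vertices : set (proj_plane R) := range vertex.
Definition edges : set (set (proj_plane R)) :=
  [set l | exists i j, i != j /\ l = edge i j].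
Definition faces : set (proj_plane R) :=
  [set x | exists i j k, is_face i j k /\ x = face i j k].

Lemma vertex_inj : injective vertex.
Proof.
move=> i j /(pt_eq (Y_neq0 gramY i) (Y_neq0 gramY j))[a _ Yij].
apply/eqP/negPn/negP => ij; have [k ik jk] := exists_third ij.
have [] := @Y_indep _ _ _ gramY i j k 1 (- a) 0 ij ik jk.
  by rewrite scale1r scaleNr scale0r addr0 Yij subrr.
by move=> /eqP; rewrite oner_eq0.
Qed.

Lemma vertex_edge (i j k : 'I_6) : i != j ->
  edge i j (vertex k) <-> k = i \/ k = j.
Proof.
move=> ij; rewrite /edge /vertex plnP ?(Y_neq0 gramY) //; split.
  move=> [a [b Yk]]; have [->|ki] := eqVneq k i; first by left.
  have [->|kj] := eqVneq k j; first by right.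
  have [] := @Y_indep _ _ _ gramY i j k a b (-1) ij.
  - by rewrite eq_sym.
  - by rewrite eq_sym.
  - by rewrite scaleN1r -Yk subrr.
  by move=> _ _ /eqP; rewrite oppr_eq0 oner_eq0.
by case=> ->; [exists 1, 0|exists 0, 1]; rewrite scale1r scale0r ?addr0 ?add0r.
Qed.

Lemma edge_meet (i j k : 'I_6) x : i != j -> i != k -> j != k ->
  edge i j x -> edge i k x -> x = vertex i.
Proof.
move=> ij ik jk; have [u u0 ->] := pt_exists x.
move=> /(plnP _ _ u0)[a [b uE]] /(plnP _ _ u0)[a' [b' uE']].
have [] := @Y_indep _ _ _ gramY i j k (a - a') b (- b') ij ik jk.
  rewrite scalerBl scaleNr; apply/eqP; rewrite subr_eq0 addrAC subr_eq -uE uE'.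
  by rewrite addrC.
move=> _ b0 _; rewrite b0 scale0r addr0 in uE.
have a0 : a != 0 by apply: contra_neq u0 => a0; rewrite uE a0 scale0r.
by rewrite uE pt_scale ?(Y_neq0 gramY).
Qed.

Lemma edge_inj (i j k l : 'I_6) : i != j -> k != l -> edge i j = edge k l ->
  (k = i /\ l = j) \/ (k = j /\ l = i).
Proof.
move=> ij kl e.
have /(vertex_edge _ ij) : edge i j (vertex k).
  by rewrite e; apply/vertex_edge => //; left.
have /(vertex_edge _ ij) : edge i j (vertex l).
  by rewrite e; apply/vertex_edge => //; right.
move=> lE kE; case: lE kE kl {e} => -> [] ->; rewrite ?eqxx //.
- by right.
- by left.
Qed.

Definition on_four_edges (x : proj_plane R) : Prop :=
  exists l : 'I_4 -> set (proj_plane R),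
    injective l /\ forall a, edges (l a) /\ l a x.

(** Two distinct edges through a point that is not a vertex join disjoint pairs of
    vertices, so at most three edges pass through it; a vertex is on five edges. This
    is why collineations preserving the edges preserve the vertices. *)
Lemma vertexP x : vertices x <-> on_four_edges x.
Proof.
split=> [[i _ <-]|[l [l_inj lx]]].
  pose n (a : 'I_4) : 'I_6 := lift i (widen_ord (leqnSn 4) a).
  have in_ a : i != n a by exact: neq_lift.
  exists (fun a => edge i (n a)); split=> [a b|a]; last first.
    by split; [exists i, (n a)|apply/vertex_edge => //; left].
  move=> /(edge_inj (in_ a) (in_ b))[[_ /lift_inj/(congr1 val)]|[ia _]].
    by move=> ba; apply: val_inj.
  by have := in_ a; rewrite -ia eqxx.
apply: contrapT => x_nv.
have /choice[p] : forall a, exists ij : 'I_6 * 'I_6, ij.1 != ij.2 /\ l a = edge ij.1 ij.2.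
  by move=> a; have [[i [j [ij lE]]] _] := lx a; exists (i, j).
move=> pl; pose end_ (ab : 'I_4 * bool) := if ab.2 then (p ab.1).1 else (p ab.1).2.
have end_edge a b : l a = edge (end_ (a, b)) (end_ (a, ~~ b)) /\
    end_ (a, b) != end_ (a, ~~ b).
  have [ij ->] := pl a; rewrite /end_ /edge; case: b => /=; first by split.
  by rewrite plnC eq_sym.
suff /leq_card : injective end_ by rewrite card_prod !card_ord card_bool.
move=> [a b] [a' b'] eE; have [lE nE] := end_edge a b; have [lE' nE'] := end_edge a' b'.
have aa' : a = a'.
  apply/l_inj; rewrite lE lE' -eE; rewrite -eE in lE' nE'.
  have [->//|nn] := eqVneq (end_ (a, ~~ b)) (end_ (a', ~~ b')).
  have [_ xa] := lx a; have [_ xa'] := lx a'.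
  case: x_nv; exists (end_ (a, b)) => //; apply/esym.
  by apply: (edge_meet nE nE' nn); rewrite -?lE -?lE'.
rewrite -aa' in eE *; congr (_, _).
have /eqP nn : end_ (a, true) != end_ (a, false) by have [] := end_edge a true.
case: b eE {lE nE}; case: b' {lE' nE'} => // e.
by case: nn.
Qed.

Definition dot (u v : 'rV[R]_3) : R := (u *m Q *m v^T) 0 0.

Lemma dotDl u v w : dot (u + v) w = dot u w + dot v w.
Proof. by rewrite /dot !mulmxDl mxE. Qed.
Lemma dotDr u v w : dot u (v + w) = dot u v + dot u w.
Proof. by rewrite /dot linearD mulmxDr mxE. Qed.
Lemma dotZl a u w : dot (a *: u) w = a * dot u w.
Proof. by rewrite /dot -!scalemxAl mxE. Qed.
Lemma dotZr a u w : dot u (a *: w) = a * dot u w.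
Proof. by rewrite /dot linearZ -scalemxAr mxE. Qed.
Lemma dotY i j : dot (Y i) (Y j) = gram R i j.
Proof. by rewrite /dot gramY mxE eqxx. Qed.

Definition dotE := (dotDl, dotDr, dotZl, dotZr, dotY).

(** The vertices of a face are the three nearest to its centre, all at the same
    angle. *)
Lemma dot_face_vec (i j k l : 'I_6) : is_face i j k ->
  if l \in [:: i; j; k] then dot (face_vec i j k) (Y l) ^+ 2 = (5 + 2 * s5) ^+ 2
  else dot (face_vec i j k) (Y l) ^+ 2 <= 45.
Proof.
have s2 := sqr_s5 R; have s4 : s5 ^+ 3 = 5 * s5 by rewrite exprS s2 mulrC.
move=> /and4P[ij ik jk]; rewrite /face_vec !dotE /gram !(inj_eq val_inj) !inE /tau /sgn.
have [->|li] /= := eqVneq l i.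
  rewrite !(eq_sym _ i) (negbTE ij) (negbTE ik) (snegC j i) (snegC k i).
  by case: sneg; case: sneg; case: sneg; rewrite //= ?expr0 ?expr1; nra.
have [->|lj] /= := eqVneq l j.
  rewrite (eq_sym k j) (negbTE jk) (snegC k j).
  by case: sneg; case: sneg; case: sneg; rewrite //= ?expr0 ?expr1; nra.
have [->|lk] /= := eqVneq l k.
  by case: sneg; case: sneg; case: sneg; rewrite //= ?expr0 ?expr1; nra.
move=> _.
by case: sneg; case: sneg; case: sneg; case: sneg; case: sneg;
  rewrite ?expr0 ?expr1; nra.
Qed.

Lemma dot_face_face (i j k : 'I_6) : is_face i j k ->
  dot (face_vec i j k) (face_vec i j k) = 3 * (5 + 2 * s5).
Proof.
have s2 := sqr_s5 R; have s4 : s5 ^+ 3 = 5 * s5 by rewrite exprS s2 mulrC.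
move=> /and4P[ij ik jk]; rewrite /face_vec !dotE /gram !(inj_eq val_inj) /tau /sgn.
rewrite !eqxx !(negbTE ij, negbTE ik, negbTE jk, eq_sym j i).
rewrite !(eq_sym k) (negbTE ik) (negbTE jk) (snegC j i) (snegC k i) (snegC k j).
by case: sneg; case: sneg; case: sneg; rewrite /= ?expr0 ?expr1 //; nra.
Qed.

Lemma face_neq0 (i j k : 'I_6) : is_face i j k -> face_vec i j k != 0.
Proof.
move=> f; apply/eqP => f0; have := dot_face_face f; rewrite f0 /dot !mul0mx mxE.
by have := s5_gt2 R; lra.
Qed.

(** On a common line the Cauchy-Schwarz inequality would be an equality. *)
Lemma faces_vertices x : faces x -> ~ vertices x.
Proof.
have s0 := s5_gt2 R; have s2 := sqr_s5 R.
move=> [i [j [k [f ->]]]] [l _ /esym].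
move=> /(pt_eq (face_neq0 f) (Y_neq0 gramY l))[a _ fE].
have ff := dot_face_face f; have := dot_face_vec l f.
have dotfl : dot (face_vec i j k) (Y l) = a * 5.
  by rewrite fE dotZl dotY /gram eqxx.
have : dot (face_vec i j k) (face_vec i j k) = a * (a * 5).
  by rewrite {2}fE dotZr dotfl.
rewrite ff dotfl; case: ifP => _; nra.
Qed.

(** A face is recovered from its centre as the set of the nearest vertices. *)
Lemma face_inj (i j k i' j' k' : 'I_6) : is_face i j k -> is_face i' j' k' ->
  face i j k = face i' j' k' -> [:: i; j; k] =i [:: i'; j'; k'].
Proof.
have s0 := s5_gt2 R; have s2 := sqr_s5 R.
move=> f f' /(pt_eq (face_neq0 f) (face_neq0 f'))[a _ fE].
have a2 : a ^+ 2 = 1.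
  have := dot_face_face f; rewrite fE dotZl dotZr (dot_face_face f') => e.
  apply: (@mulfI _ (3 * (5 + 2 * s5))); first by rewrite gt_eqF //; nra.
  by rewrite mulr1 -[RHS]e; ring.
move=> l; have := dot_face_vec l f; have := dot_face_vec l f'.
rewrite fE dotZl exprMn a2 mul1r.
by case: (l \in _); case: (l \in _) => // e e'; exfalso; nra.
Qed.
End HemiIcosahedron.

(** * The stabilizer of the hemi-icosahedron *)

Section Stabilizer.
Context (R : realType) (Y : 'I_6 -> 'rV[R]_3) (Q : 'M[R]_3).
Hypothesis gramY : forall i j, Y i *m Q *m (Y j)^T = (gram R i j)%:M.

Local Notation vertex := (vertex Y).
Local Notation edge := (edge Y).
Local Notation face := (face Y).
Local Notation vertices := (vertices Y).
Local Notation edges := (edges Y).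
Local Notation faces := (faces Y).
Local Notation points := (vertices `|` faces).
Local Notation stab := (stabilizer points edges).

Lemma pln_scale (a b : R) (u v : 'rV[R]_3) : a != 0 -> b != 0 ->
  pln (a *: u) (b *: v) = pln u v.
Proof.
have vline_scale (c : R) (w : 'rV[R]_3) : c != 0 -> (<[c *: w]> = <[w]>)%VS.
  move=> c0; apply/eqP; rewrite eqEsubv -!memvE memvZ ?memv_line //=.
  by rewrite -[w in w \in _](scalerK c0) memvZ ?memv_line.
by move=> a0 b0; rewrite /pln !vline_scale.
Qed.

Lemma aut_face (s : 'S_6) (i j k : 'I_6) : two_graph_aut s ->
  is_face (s i) (s j) (s k) = is_face i j k.
Proof. by move=> aut_s; rewrite /is_face !(inj_eq perm_inj) aut_s. Qed.

Lemma aut_inv (s : 'S_6) : two_graph_aut s -> two_graph_aut s^-1%g.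
Proof. by move=> aut_s i j k; rewrite -aut_s !permKV. Qed.

Lemma lift_mx_unit (s : 'S_6) : two_graph_aut s -> lift_mx Y Q s \in unitmx.
Proof.
move=> aut_s; have n50 : ord_max != ord0 :> 'I_6 by [].
have n51 : ord_max != inord 1 :> 'I_6 by rewrite -(inj_eq val_inj) /= inordK.
have n01 : ord0 != inord 1 :> 'I_6 by rewrite -(inj_eq val_inj) /= inordK.
have df : \det (frame Y (triple (s ord_max) (s ord0) (s (inord 1)))) != 0.
  by rewrite -unitfE -unitmxE (unit_frame gramY) ?(inj_eq perm_inj).
have dM := det_frameM (lift_mxE gramY aut_s) ord_max ord0 (inord 1).
rewrite unitmxE unitfE; apply: contra_eq_neq dM => ->.
by rewrite mulr0 eq_sym !mulf_neq0 ?sgn_neq0 ?pnatr_eq0.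
Qed.

(** Edges and face centres are defined from the vertices and the signs, so the linear
    map realizing [s] on the vertices carries them along. *)
Lemma realize (s : 'S_6) : two_graph_aut s -> exists g : stab,
  [/\ forall i, g (vertex i) = vertex (s i),
      forall i j, g @` edge i j = edge (s i) (s j)
    & forall i j k, is_face i j k -> g (face i j k) = face (s i) (s j) (s k)].
Proof.
move=> aut_s; have [g gM] := represents_pgl (lift_mx_unit aut_s).
have YM := lift_mxE gramY aut_s.
have c0 i : 10 * lift_sign R s i != 0 by rewrite mulf_neq0 ?lift_sign_neq0 ?pnatr_eq0.
have gv i : g (vertex i) = vertex (s i).
  by rewrite /vertex (represents_pt gM) ?(Y_neq0 gramY) // YM pt_scale ?(Y_neq0 gramY).
have ge i j : g @` edge i j = edge (s i) (s j).
  by rewrite /edge (represents_pln _ _ gM) !YM pln_scale.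
have gf i j k : is_face i j k -> g (face i j k) = face (s i) (s j) (s k).
  move=> f; rewrite /face (represents_pt gM) ?(face_neq0 gramY) //.
  rewrite -[RHS](pt_scale (c0 i)) ?(face_neq0 gramY) ?aut_face //; congr pt.
  rewrite /face_vec !mulmxDl -!scalemxAl !YM !scalerDr !scalerA.
  by congr (_ + _ *: _ + _ *: _); rewrite mulrCA [in LHS]mulrC -mulrA;
    rewrite mulrC [sgn _ _ _ * _]mulrC sgn_aut //; ring.
have pres : preserves points edges g.
  apply/asboolP; split; apply/seteqP; split.
  - move=> _ [x [[i _ <-]|[i [j [k [f ->]]]]] <-]; [left|right].
      by rewrite gv; exists (s i).
    by rewrite gf //; exists (s i), (s j), (s k); rewrite aut_face.
  - move=> _ [[i _ <-]|[i [j [k [f ->]]]]].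
      exists (vertex (s^-1 i)%g); last by rewrite gv permKV.
      by left; exists (s^-1 i)%g.
    have f' : is_face (s^-1 i)%g (s^-1 j)%g (s^-1 k)%g by rewrite aut_face //; exact: aut_inv.
    exists (face (s^-1 i)%g (s^-1 j)%g (s^-1 k)%g); last by rewrite gf // !permKV.
    by right; exists (s^-1 i)%g, (s^-1 j)%g, (s^-1 k)%g.
  - move=> _ [_ [i [j [ij ->]]] <-]; rewrite ge.
    by exists (s i), (s j); rewrite (inj_eq perm_inj).
  - move=> _ [i [j [ij ->]]]; exists (edge (s^-1 i)%g (s^-1 j)%g).
      by exists (s^-1 i)%g, (s^-1 j)%g; rewrite (inj_eq perm_inj).
    by rewrite ge !permKV.
by exists (Stabilizer pres).
Qed.

Lemma stab_preserves (g : stab) : g @` points = points /\ [set g @` l | l in edges] = edges.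
Proof. exact/asboolP/(valP g). Qed.

Lemma pgl_inj (g : pgl R) : injective g.
Proof.
have gK : cancel g (g^-1)%g by move=> x; rewrite -[LHS]/((g^-1 * g)%g x) mulVg.
exact: can_inj gK.
Qed.

Lemma pgl_imageM (g h : pgl R) (A : set (proj_plane R)) :
  (g * h)%g @` A = g @` (h @` A).
Proof. by rewrite image_comp. Qed.

Lemma pgl_imageK (g : pgl R) (A : set (proj_plane R)) : (g^-1)%g @` (g @` A) = A.
Proof. by rewrite -pgl_imageM mulVg; exact: image_id. Qed.

Lemma stab_vertices (g : stab) x : vertices x -> vertices (g x).
Proof.
move=> /(vertexP gramY)[l [l_inj lx]]; apply/(vertexP gramY).
have gL l' : edges l' -> edges (g @` l').
  by have [_ e] := stab_preserves g; rewrite -{2}e; exists l'.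
exists (fun a => g @` l a); split=> [a b|a].
  by move=> /(congr1 (image^~ (g^-1)%g)); rewrite !pgl_imageK => /l_inj.
by have [la ax] := lx a; split; [exact: gL|exists x].
Qed.

Lemma represents_vertex (M : 'M[R]_3) (g : pgl R) (i j : 'I_6) : represents M g ->
  g (vertex i) = vertex j -> exists c, c != 0 /\ Y i *m M = c *: Y j.
Proof.
move=> gM; rewrite /vertex (represents_pt gM) ?(Y_neq0 gramY) //.
move=> /pt_eq[||c c0 ->]; [|exact: (Y_neq0 gramY)|by exists c].
have [uM _] := gM; apply: contra_neq (Y_neq0 gramY i) => YM0.
by rewrite -(mulmxK uM (Y i)) YM0 mul0mx.
Qed.

Lemma stab_acts (g : stab) :
  exists s : 'S_6, two_graph_aut s /\ forall i, g (vertex i) = vertex (s i).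
Proof.
have /choice[f gf] : forall i, exists j, g (vertex i) = vertex j.
  by move=> i; have [j _ <-] := stab_vertices g (imageT vertex i); exists j.
have f_inj : injective f.
  by move=> i j fij; apply/(vertex_inj gramY)/(@pgl_inj g); rewrite !gf fij.
exists (perm f_inj); split; last by move=> i; rewrite permE.
have [M gM] := represents_ex g.
have /choice[c cM] := fun i => represents_vertex gM (gf i).
apply: (@collineation_aut _ _ _ gramY M _ c) => i; last by have [] := cM i.
by rewrite permE; have [] := cM i.
Qed.

Lemma stab_acts1 (g : stab) : (forall i, g (vertex i) = vertex i) -> g = 1%g.
Proof.
move=> g1; apply: val_inj => /=; have [M gM] := represents_ex g.
have /choice[c cM] := fun i => represents_vertex gM (g1 i).
have [a Ma] : exists a, M = a%:M.
  apply: (@collineation_id _ _ _ gramY M 1%g c) => // i; last by have [] := cM i.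
  by rewrite perm1; have [] := cM i.
by rewrite Ma in gM; apply: represents_scalar gM.
Qed.

(** The product of the group is composition while permutations compose from left to
    right; hence the inverse in the isomorphism. *)
Lemma stab_Alt5 : isomorphic stab [subg 'Alt_('I_5)].
Proof.
have /choice[S S_acts] := stab_acts.
have S_aut g : two_graph_aut (S g) by have [] := S_acts g.
have S_vertex (g : stab) i : g (vertex i) = vertex (S g i) by have [] := S_acts g.
have S_M g h : S (g * h)%g = (S h * S g)%g.
  apply/permP => i; apply: (vertex_inj gramY).
  by rewrite -S_vertex permM -!S_vertex.
pose F (g : stab) : [subg 'Alt_('I_5)] := subg _ (sigma (S g))^-1%g.
have F_morph : {morph F : g h / (g * h)%g}.
  move=> g h; rewrite /F S_M sigmaM ?S_aut // invMg.
  by rewrite subgM // groupV; exact: sigma_even.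
have F_inj : injective F.
  move=> g h /(congr1 sgval); rewrite !subgK ?groupV; try exact: sigma_even.
  move=> /invg_inj Sgh; suff k1 : (h^-1 * g)%g = 1%g by rewrite -(mulKVg h g) k1 mulg1.
  apply: stab_acts1 => i; rewrite S_vertex.
  have -> : S (h^-1 * g)%g = 1%g; last by rewrite perm1.
  apply: sigma_eq1 => //; apply: (mulIg (sigma (S h))).
  by rewrite -sigmaM // -S_M mulKVg Sgh mul1g.
have F_surj u : exists g, F g = u.
  have [s aut_s su] : exists2 s, two_graph_aut s & sigma s = (sgval u)^-1%g.
    by apply: sigma_onto; rewrite groupV subgP.
  have [g [gv _ _]] := realize aut_s; exists g.
  have -> : F g = subg _ (sgval u); last by rewrite sgvalK.
  rewrite /F; congr subg; rewrite -[RHS]invgK -su; congr (sigma _)^-1%g.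
  by apply/permP => i; apply: (vertex_inj gramY); rewrite -S_vertex gv.
have /choice[G FG] := F_surj.
pose F_mul := isMultiplicative.Build _ _ F F_morph.
pose Fm : {multiplicative stab -> [subg 'Alt_('I_5)]} := HB.pack F F_mul.
by exists Fm; exists G => // g; apply: F_inj; rewrite FG.
Qed.

(** * Orbits *)

Lemma stab_orbit_base (S : set (proj_plane R)) (b x : proj_plane R) :
  (forall y, S y -> exists g : stab, g b = y) ->
  (forall (g : stab) y, S y -> S (g y)) -> S x -> stab_orbit points edges x = S.
Proof.
move=> trans inv Sx; apply/seteqP; split=> [_ [g _ <-]|y Sy]; first exact: inv.
have [h <-] := trans _ Sy; have [g gx] := trans _ Sx; exists (h * g^-1)%g => //.
by rewrite -gx -[LHS]/((h * g^-1 * g)%g b) mulgKV.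
Qed.

Lemma stab_faces (g : stab) x : faces x -> faces (g x).
Proof.
move=> fx; have [gX _] := stab_preserves g.
have : (g @` points) (g x) by exists x => //; right.
rewrite gX => -[gx|//]; case: (faces_vertices gramY fx).
by have := stab_vertices (g^-1)%g gx; rewrite -[X in vertices X]/((g^-1 * g)%g x) mulVg.
Qed.

Lemma orbit_vertices x : vertices x -> stab_orbit points edges x = vertices.
Proof.
apply: (@stab_orbit_base _ (vertex ord_max)) => [_ [i _ <-]|g y]; last exact: stab_vertices.
have [j ij] : exists j, i != j by exists (lift i ord0); exact: neq_lift.
have [s aut_s [si _]] := aut_trans2 ij; have [g [gv _ _]] := realize aut_s.
by exists g; rewrite gv si.
Qed.

Lemma orbit_faces x : faces x -> stab_orbit points edges x = faces.
Proof.
apply: (@stab_orbit_base _ (face ord_max ord0 (inord 1))); last exact: stab_faces.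
move=> _ [i [j [k [f ->]]]]; have /and4P[ij ik jk t] := f.
have [s aut_s [si sj sk]] := aut_trans3 ij ik jk t.
have [g [_ _ gf]] := realize aut_s; exists g; rewrite gf ?si ?sj ?sk //.
by rewrite -(aut_face _ _ _ aut_s) si sj sk.
Qed.

(** The vertices and the face centres are the two orbits, since automorphisms of the
    two-graph are transitive on both. *)
Lemma orbits_points :
  [set stab_orbit points edges x | x in points] = [set vertices; faces].
Proof.
apply/seteqP; split=> [_ [x [vx|fx] <-]|_ [->|->]].
- by left; exact: orbit_vertices.
- by right; exact: orbit_faces.
- have vx : vertices (vertex ord0) by exists ord0.
  by exists (vertex ord0); [left|exact: orbit_vertices].
- have fx : faces (face ord_max ord0 (inord 1)).
    exists ord_max, ord0, (inord 1); split=> //.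
    by rewrite /is_face -!(inj_eq val_inj) /= !inordK.
  by exists (face ord_max ord0 (inord 1)); [right|exact: orbit_faces].
Qed.

Lemma edges_trans l1 l2 : edges l1 -> edges l2 -> exists g : stab, g @` l1 = l2.
Proof.
move=> [i [j [ij ->]]] [k [l [kl ->]]].
have [s aut_s [<- <-]] := aut_trans2 ij; have [t aut_t [<- <-]] := aut_trans2 kl.
have [g [_ ge _]] := realize aut_s; have [h [_ he _]] := realize aut_t.
exists (h * g^-1)%g; rewrite -ge -he.
by rewrite -[LHS]/((h * g^-1)%g @` (g @` _)) -pgl_imageM mulgKV.
Qed.

(** * Cardinalities *)

Lemma card_vertices : vertices #= `I_6.
Proof.
have -> : vertices = vertex @` [set i | i \in 'I_6].
  by apply/seteqP; split=> [_ [i _ <-]|_ [i _ <-]]; exists i.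
have := @card_image_fin _ _ vertex 'I_6 (in2W (vertex_inj gramY)).
by rewrite card_ord.
Qed.

Lemma card_edges : edges #= `I_15.
Proof.
pose D := [pred p : 'I_6 * 'I_6 | (p.1 < p.2)%N].
have -> : edges = (fun p => edge p.1 p.2) @` [set p | p \in D].
  apply/seteqP; split=> [_ [i [j [ij ->]]]|_ [[i j] /= ij <-]].
    have [lt|gt|/val_inj e] := ltngtP i j.
    - by exists (i, j).
    - by exists (j, i) => //=; rewrite /edge plnC.
    - by rewrite e eqxx in ij.
  by exists i, j; split=> //; rewrite -(inj_eq val_inj) /= ltn_eqF.
have <- : #|D| = 15%N.
  rewrite -sum1_card big_mkcond /=.
  rewrite -(pair_bigA _ (fun i j : 'I_6 => if (i < j)%N then 1%N else 0%N)) /=.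
  by rewrite !big_ord_recl !big_ord0.
apply: card_image_fin => -[i j] [k l]; rewrite !inE /= => ij kl.
have neq (a b : 'I_6) : (a < b)%N -> a != b.
  by move=> ab; rewrite -(inj_eq val_inj) /= ltn_eqF.
move=> /(edge_inj gramY (neq _ _ ij) (neq _ _ kl))[[-> ->]//|[ki lj]].
by move: kl; rewrite ki lj ltnNge ltnW.
Qed.

Lemma face_swap23 (i j k : 'I_6) : face i k j = face i j k.
Proof. by rewrite /face /face_vec addrAC. Qed.

Lemma face_swap12 (i j k : 'I_6) : is_face i j k -> face j i k = face i j k.
Proof.
move=> f; have /and4P[_ _ _ t] := f.
rewrite -[RHS](pt_scale (sgn_neq0 R i j)) ?(face_neq0 gramY) //; congr pt.
rewrite /face_vec !scalerDr !scalerA (sgnC R j i) [LHS]addrAC [RHS]addrAC.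
rewrite addrC [RHS]addrC addrA [in RHS]addrCA addrA; move: t; rewrite /tau /sgn.
by case: sneg; case: sneg; case: sneg; rewrite //= ?expr0 ?expr1 ?mulN1r ?opprK ?mul1r ?scale1r.
Qed.

Lemma is_face_swap12 (i j k : 'I_6) : is_face j i k = is_face i j k.
Proof.
rewrite /is_face /tau (snegC j i) (eq_sym j i).
by case: sneg; case: sneg; case: sneg; case: eqP; case: eqP; case: eqP.
Qed.

Lemma is_face_swap23 (i j k : 'I_6) : is_face i k j = is_face i j k.
Proof.
rewrite /is_face /tau (snegC k j) (eq_sym k j).
by case: sneg; case: sneg; case: sneg; case: eqP; case: eqP; case: eqP.
Qed.

Lemma face_perm (i j k : 'I_6) : is_face i j k ->
  [/\ face j i k = face i j k, face j k i = face i j k, face i k j = face i j k,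
      face k i j = face i j k & face k j i = face i j k].
Proof.
move=> f; have e1 := face_swap12 f.
have f' : is_face i k j by rewrite is_face_swap23.
have e3 : face k i j = face i j k := etrans (face_swap12 f') (face_swap23 i j k).
split=> //; first exact: etrans (face_swap23 j i k) e1.
  exact: face_swap23.
exact: etrans (face_swap23 k i j) e3.
Qed.

Lemma faces_sorted x : faces x ->
  exists i j k, [/\ is_face i j k, (i < j)%N, (j < k)%N & x = face i j k].
Proof.
suff main (i j k : 'I_6) : (i < j)%N -> is_face i j k ->
    exists i' j' k', [/\ is_face i' j' k', (i' < j')%N, (j' < k')%N
                       & face i j k = face i' j' k'].
  move=> [i [j [k [f ->]]]]; have /and4P[ij _ _ _] := f.
  have [lt|gt|/val_inj e] := ltngtP i j; first exact: main.
    have f' : is_face j i k by rewrite is_face_swap12.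
    by rewrite (face_swap12 f'); exact: main.
  by rewrite e eqxx in ij.
move=> ij f; have /and4P[_ ik jk _] := f.
have [lt|kj|/val_inj e] := ltngtP j k; first by exists i, j, k.
  have f' : is_face i k j by rewrite is_face_swap23.
  have [lt|ki|/val_inj e] := ltngtP i k.
  - by exists i, k, j; rewrite face_swap23.
  - by exists k, i, j; rewrite is_face_swap12 (face_swap12 f') face_swap23.
  - by rewrite e eqxx in ik.
by rewrite e eqxx in jk.
Qed.

Lemma card_faces : faces #= `I_10.
Proof.
pose P (i j k : nat) := [&& (i < j)%N, (j < k)%N & ~~ tau i j k].
pose D := [pred p : 'I_6 * ('I_6 * 'I_6) | P p.1 p.2.1 p.2.2].
have D_face (i j k : 'I_6) : P i j k -> is_face i j k.
  move=> /and3P[ij jk t]; rewrite /is_face t -!(inj_eq val_inj) /=.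
  by rewrite !ltn_eqF // (ltn_trans ij).
have -> : faces = (fun p => face p.1 p.2.1 p.2.2) @` [set p | p \in D].
  apply/seteqP; split=> [_ /faces_sorted[i [j [k [f ij jk ->]]]]|].
    exists (i, (j, k)) => //=; rewrite inE /= /P ij jk.
    by have /and4P[_ _ _ ->] := f.
  move=> _ [[i [j k]] /= Pijk <-]; exists i, j, k; split=> //.
  by apply: D_face; move: Pijk; rewrite inE.
have <- : #|D| = 10%N.
  rewrite -sum1_card big_mkcond /=.
  rewrite -(pair_bigA _ (fun (i : 'I_6) (p : 'I_6 * 'I_6) =>
    if P i p.1 p.2 then 1%N else 0%N)) /=.
  under eq_bigr => i _ do
    rewrite -(pair_bigA _ (fun j k : 'I_6 => if P i j k then 1%N else 0%N)) /=.
  transitivity (\sum_(0 <= i < 6) \sum_(0 <= j < 6) \sum_(0 <= k < 6)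
    (if P i j k then 1 else 0))%N; last by rewrite unlock; vm_compute.
  rewrite big_mkord; apply: eq_bigr => i _; rewrite big_mkord.
  by apply: eq_bigr => j _; rewrite big_mkord.
apply: card_image_fin => -[i [j k]] [i' [j' k']]; rewrite !inE /= => Pijk Pijk'.
move=> /(face_inj gramY (D_face _ _ _ Pijk) (D_face _ _ _ Pijk')) e.
have /(congr1 (map val))/= : [:: i; j; k] = [:: i'; j'; k'].
  apply: (@irr_sorted_eq _ (fun a b : 'I_6 => (a < b)%N)) => //.
  - by move=> a b c; apply: ltn_trans.
  - by move=> a; rewrite /= ltnn.
  - by rewrite /= andbT; case/and3P: Pijk => -> ->.
  - by rewrite /= andbT; case/and3P: Pijk' => -> ->.
by move=> [/val_inj -> /val_inj -> /val_inj ->].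
Qed.

End Stabilizer.

(** * Trigonometry of the regular pentagon *)

Section Pentagon.
Context (R : realType).

Definition turn_cos (k : nat) : R := cos (2 * pi * k%:R / 5).

Local Notation c1 := (turn_cos 1).
Local Notation c2 := (turn_cos 2).

Lemma cos_turns (x : R) (n : nat) : cos (x + 2 * pi * n%:R) = cos x.
Proof.
have -> : 2 * pi * n%:R = (pi *+ 2) *+ n :> R.
  by rewrite -[RHS]mulr_natr -[pi *+ 2]mulr_natl.
exact: (periodicn (@cosD2pi R)).
Qed.

Lemma sin_turns (x : R) (n : nat) : sin (x + 2 * pi * n%:R) = sin x.
Proof.
have -> : 2 * pi * n%:R = (pi *+ 2) *+ n :> R.
  by rewrite -[RHS]mulr_natr -[pi *+ 2]mulr_natl.
exact: (periodicn (@sinD2pi R)).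
Qed.

Lemma angle_mod (k : nat) : 2 * pi * k%:R / 5 =
  2 * pi * (k %% 5)%:R / 5 + 2 * pi * (k %/ 5)%:R :> R.
Proof. by rewrite {1}(divn_eq k 5) natrD natrM; field. Qed.

Lemma turn_cos_mod (k : nat) : turn_cos (k %% 5) = turn_cos k.
Proof. by rewrite /turn_cos (angle_mod k) cos_turns. Qed.

Lemma turn_cos2E : c2 = 2 * c1 ^+ 2 - 1.
Proof.
rewrite /turn_cos; have -> : 2 * pi * 2 / 5 = (2 * pi * 1 / 5) *+ 2 :> R.
  by rewrite -[RHS]mulr_natr; field.
by rewrite cos_mulr2n -mulr_natl.
Qed.

Lemma turn_cosN (k : nat) : (k <= 5)%N -> turn_cos (5 - k) = turn_cos k.
Proof.
move=> k5; rewrite /turn_cos natrB // -[LHS]cosN.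
have -> : - (2 * pi * (5 - k%:R) / 5) = 2 * pi * k%:R / 5 - 2 * pi :> R by field.
by rewrite -[LHS](cos_turns _ 1) mulr1 subrK.
Qed.

Lemma turn_cos1_gt0 : 0 < c1.
Proof.
apply: cos_gt0_pihalf; have := pi_gt0 R => p0; apply/andP; split; lra.
Qed.

(** With [x] the cosine of 72 degrees, the equality of the cosines of 2 * 72 and
    3 * 72 degrees reads [(x - 1) * (4 * x ^+ 2 + 2 * x - 1) = 0]. *)
Lemma turn_cos1_eq : 4 * c1 ^+ 2 + 2 * c1 - 1 = 0.
Proof.
have c1_neq1 : c1 != 1.
  have p0 := pi_gt0 R; rewrite lt_eqF // /turn_cos -[X in _ < X]cos0.
  rewrite ltr_cos ?in_itv /=; first by lra.
    by apply/andP; split; lra.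
  by apply/andP; split; lra.
have c3E : turn_cos 3 = 4 * c1 ^+ 3 - 3 * c1.
  rewrite /turn_cos; set x := 2 * pi * 1 / 5.
  have -> : 2 * pi * 3 / 5 = x *+ 2 + x by rewrite -[x *+ 2]mulr_natr /x; field.
  rewrite cosD cos_mulr2n sin_mulr2n; have := sin2cos2 x.
  rewrite -[cos x ^+ 2 *+ 2]mulr_natl -[(cos x * sin x) *+ 2]mulr_natl => s2.
  have -> : 2%:R * (cos x * sin x) * sin x = 2 * cos x * sin x ^+ 2 by ring.
  by rewrite s2; ring.
have := turn_cosN (isT : 2 <= 5)%N; rewrite -[(5 - 2)%N]/3%N c3E turn_cos2E => e.
apply/eqP; have /eqP : (c1 - 1) * (4 * c1 ^+ 2 + 2 * c1 - 1) = 0.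
  by move: e => /eqP; rewrite -subr_eq0 => /eqP e; rewrite -[RHS]e; ring.
by rewrite mulf_eq0 subr_eq0 (negbTE c1_neq1).
Qed.

Lemma turn_cos2_lin : c2 = - c1 - 1 / 2.
Proof. by have := turn_cos1_eq; rewrite turn_cos2E; lra. Qed.

Lemma sqrt5E : Num.sqrt 5 = 4 * c1 + 1.
Proof.
have -> : 5 = (4 * c1 + 1) ^+ 2 by have := turn_cos1_eq; lra.
by rewrite sqrtr_sqr ger0_norm //; have := turn_cos1_gt0; lra.
Qed.

Lemma turn_cosE (k : nat) : (k < 5)%N ->
  turn_cos k = if k == 0%N then 1 else if k \in [:: 2; 3]%N then c2 else c1.
Proof.
case: k => [|[|[|[|[|//]]]]] _ //=.
- by rewrite /turn_cos mulr0 mul0r cos0.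
- by rewrite -(@turn_cosN 2).
- by rewrite -(@turn_cosN 1).
Qed.

Lemma turn_cos_neq0 (k : nat) : turn_cos k != 0.
Proof.
rewrite -turn_cos_mod turn_cosE ?ltn_pmod //; have := turn_cos1_gt0 => c0.
case: ifP => _; first exact: oner_neq0.
by case: ifP => _; rewrite ?turn_cos2_lin; [rewrite lt_eqF|rewrite gt_eqF] => //; lra.
Qed.

Section Directions.
Context (th : R).

Definition dirx (k : nat) : R := cos (th + 2 * pi * k%:R / 5).
Definition diry (k : nat) : R := sin (th + 2 * pi * k%:R / 5).

Lemma dirx_mod k : dirx (k %% 5) = dirx k.
Proof. by rewrite /dirx (angle_mod k) addrA cos_turns. Qed.

Lemma diry_mod k : diry (k %% 5) = diry k.
Proof. by rewrite /diry (angle_mod k) addrA sin_turns. Qed.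

Lemma dir_dot (j k : nat) :
  dirx j * dirx k + diry j * diry k = turn_cos ((j + 4 * k) %% 5).
Proof.
rewrite turn_cos_mod /turn_cos /dirx /diry -cosB.
rewrite -[LHS](cos_turns _ k); congr cos; rewrite natrD natrM.
by field.
Qed.

(** The reflection in the direction [k] sends the direction [j] to [2 * k - j]. *)
Lemma dirx_refl (j k : nat) : dirx (2 * k + 4 * j) + dirx j =
  2 * turn_cos ((j + 4 * k) %% 5) * dirx k.
Proof.
rewrite -dir_dot /dirx /diry.
set b := th + 2 * pi * j%:R / 5; set g := th + 2 * pi * k%:R / 5.
have -> : th + 2 * pi * (2 * k + 4 * j)%:R / 5 = (g + (g - b)) + 2 * pi * j%:R.
  by rewrite /b /g natrD !natrM; field.
rewrite cos_turns cosD cosB sinB -[X in _ + X = _]mulr1 -[X in _ + _ * X = _](cos2Dsin2 g); ring.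
Qed.

Lemma diry_refl (j k : nat) : diry (2 * k + 4 * j) + diry j =
  2 * turn_cos ((j + 4 * k) %% 5) * diry k.
Proof.
rewrite -dir_dot /dirx /diry.
set b := th + 2 * pi * j%:R / 5; set g := th + 2 * pi * k%:R / 5.
have -> : th + 2 * pi * (2 * k + 4 * j)%:R / 5 = (g + (g - b)) + 2 * pi * j%:R.
  by rewrite /b /g natrD !natrM; field.
rewrite sin_turns sinD cosB sinB -[X in _ + X = _]mulr1 -[X in _ + _ * X = _](cos2Dsin2 g); ring.
Qed.

Lemma dir_norm (k : nat) : dirx k ^+ 2 + diry k ^+ 2 = 1.
Proof. exact: cos2Dsin2. Qed.

Lemma dir_sum : \sum_(k < 5) dirx k = 0 /\ \sum_(k < 5) diry k = 0.
Proof.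
have c0 := turn_cos2_lin.
have x1 : dirx 4 + dirx 1 = 2 * c1 * dirx 0 := dirx_refl 1 0.
have x2 : dirx 8 + dirx 2 = 2 * c2 * dirx 0 := dirx_refl 2 0.
have y1 : diry 4 + diry 1 = 2 * c1 * diry 0 := diry_refl 1 0.
have y2 : diry 8 + diry 2 = 2 * c2 * diry 0 := diry_refl 2 0.
rewrite -dirx_mod c0 /= in x2; rewrite -diry_mod c0 /= in y2.
by rewrite !big_ord_recr !big_ord0 /=; split; nra.
Qed.
End Directions.
End Pentagon.

(** * The pentagrams and the axes *)

Section EuclideanLines.
Context (R : realType).
Implicit Types p q x : plane R.

(** Twice the signed area of the triangle [p], [x], [q]. *)
Definition area p q x : R :=
  (x.1 - p.1) * (q.2 - p.2) - (x.2 - p.2) * (q.1 - p.1).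

Lemma plane_dist_neq0 p q : p <> q -> (q.1 - p.1) ^+ 2 + (q.2 - p.2) ^+ 2 != 0.
Proof.
move=> pq; apply/eqP => /eqP; rewrite paddr_eq0 ?sqr_ge0 // !sqrf_eq0 !subr_eq0.
by move=> /andP[/eqP e1 /eqP e2]; apply: pq;
  rewrite [p]surjective_pairing -e1 -e2 -surjective_pairing.
Qed.

Lemma line_throughE p q : p <> q -> line_through p q = [set x | area p q x = 0].
Proof.
move=> pq; have d0 := plane_dist_neq0 pq; apply/seteqP; split=> [_ [t _ <-]|[a b] /= e].
  by rewrite /area /=; ring.
exists (((a - p.1) * (q.1 - p.1) + (b - p.2) * (q.2 - p.2)) /
    ((q.1 - p.1) ^+ 2 + (q.2 - p.2) ^+ 2)) => //.
move: e; rewrite /area /= => /eqP; rewrite subr_eq0 => /eqP e; congr (_, _).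
  transitivity (p.1 + ((a - p.1) * (q.1 - p.1) * (q.1 - p.1)
      + (a - p.1) * (q.2 - p.2) * (q.2 - p.2)) /
    ((q.1 - p.1) ^+ 2 + (q.2 - p.2) ^+ 2)); last by field.
  by rewrite e; field.
transitivity (p.2 + ((b - p.2) * (q.1 - p.1) * (q.1 - p.1)
    + (b - p.2) * (q.2 - p.2) * (q.2 - p.2)) /
  ((q.1 - p.1) ^+ 2 + (q.2 - p.2) ^+ 2)); last by field.
by rewrite -e; field.
Qed.

Lemma area_reflection p q x : p <> q -> area p q (reflection p q x) = - area p q x.
Proof.
by move=> /plane_dist_neq0 d0; rewrite /area /reflection /foot /=; field.
Qed.

Lemma reflectionK p q : p <> q -> involutive (reflection p q).
Proof.
move=> /plane_dist_neq0 d0 [a b]; rewrite /reflection /foot /=.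
by congr (_, _); field.
Qed.

Lemma eq_line p q (n : R * R) (e : R) : p <> q ->
  n.1 * p.1 + n.2 * p.2 = e -> n.1 * q.1 + n.2 * q.2 = e -> n.1 ^+ 2 + n.2 ^+ 2 != 0 ->
  line_through p q = [set x | n.1 * x.1 + n.2 * x.2 = e].
Proof.
move=> pq pe qe n0; have d0 := plane_dist_neq0 pq; rewrite line_throughE //.
have un : n.1 * (q.1 - p.1) + n.2 * (q.2 - p.2) = 0.
  by rewrite !mulrBr addrACA -opprD pe qe subrr.
apply/seteqP; split=> x /= xe.
  apply/eqP; rewrite -subr_eq0 -pe opprD addrACA -!mulrBr.
  rewrite -(mulrI_eq0 _ (mulfI d0)); apply/eqP.
  move: xe un; rewrite /area.
  set a := x.1 - p.1; set b := x.2 - p.2; set u := q.1 - p.1; set w := q.2 - p.2.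
  move=> xe un.
  have -> : (u ^+ 2 + w ^+ 2) * (n.1 * a + n.2 * b) =
    (n.1 * u + n.2 * w) * (a * u + b * w) + (n.1 * w - n.2 * u) * (a * w - b * u) by ring.
  by rewrite xe un mul0r mulr0 addr0.
have xp : n.1 * (x.1 - p.1) + n.2 * (x.2 - p.2) = 0.
  by rewrite !mulrBr addrACA -opprD pe xe subrr.
apply/eqP; rewrite -(mulrI_eq0 _ (mulfI n0)); apply/eqP; rewrite /area.
move: xp un.
set a := x.1 - p.1; set b := x.2 - p.2; set u := q.1 - p.1; set w := q.2 - p.2.
move=> xp un.
have -> : (n.1 ^+ 2 + n.2 ^+ 2) * (a * w - b * u) =
  (n.1 * a + n.2 * b) * (n.1 * w - n.2 * u) - (n.1 * b - n.2 * a) * (n.1 * u + n.2 * w)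
  by ring.
by rewrite xp un mul0r mulr0 subrr.
Qed.
End EuclideanLines.

Section Pentagrams.
Context (R : realType) (O : plane R).

Local Notation c1 := (turn_cos R 1).
Local Notation c2 := (turn_cos R 2).

(** The vertices of a regular pentagon; a negative [rho] makes a half-turn. *)
Definition spoke (th rho : R) (k : nat) : plane R :=
  (O.1 + rho * dirx th k, O.2 + rho * diry th k).

Definition pentagon (th rho : R) : set (plane R) :=
  [set spoke th rho k | k in [set: 'I_5]].

Lemma spoke_mod th rho k : spoke th rho (k %% 5) = spoke th rho k.
Proof. by rewrite /spoke dirx_mod diry_mod. Qed.

Lemma pentagonP th rho x : pentagon th rho x <-> exists k : nat, x = spoke th rho k.
Proof.
split=> [[k _ <-]|[k ->]]; first by exists k.
by exists (inord (k %% 5)) => //; rewrite inordK ?spoke_mod // ltn_pmod.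
Qed.

(** The line joining the two neighbours of the vertex [p] of a regular pentagon. *)
Definition diag_line (p : plane R) : set (plane R) :=
  [set x | (x.1 - O.1) * (p.1 - O.1) + (x.2 - O.2) * (p.2 - O.2) =
           c1 * ((p.1 - O.1) ^+ 2 + (p.2 - O.2) ^+ 2)].

Section Fixed.
Context (th rho : R).
Hypothesis rho0 : rho != 0.

Lemma diagonalE k x : diag_line (spoke th rho k) x <->
  (x.1 - O.1) * dirx th k + (x.2 - O.2) * diry th k = rho * c1.
Proof.
rewrite /diag_line /spoke /= ![_ + _ - O.1]addrC ![_ + _ - O.2]addrC !addKr.
have -> : (x.1 - O.1) * (rho * dirx th k) + (x.2 - O.2) * (rho * diry th k) =
  rho * ((x.1 - O.1) * dirx th k + (x.2 - O.2) * diry th k) by ring.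
have -> : c1 * ((rho * dirx th k) ^+ 2 + (rho * diry th k) ^+ 2) = rho * (rho * c1).
  by rewrite !exprMn -mulrDr dir_norm; ring.
by split=> [/(mulfI rho0)//|->].
Qed.

Lemma diagonal_spoke rho' j k : diag_line (spoke th rho k) (spoke th rho' j) <->
  rho' * turn_cos R ((j + 4 * k) %% 5) = rho * c1.
Proof.
rewrite diagonalE /spoke /= ![_ + _ - O.1]addrC ![_ + _ - O.2]addrC !addKr.
by rewrite -!mulrA -mulrDr dir_dot.
Qed.

Lemma spoke_inj : injective (fun k : 'I_5 => spoke th rho k).
Proof.
move=> j k [/addrI/(mulfI rho0) ex /addrI/(mulfI rho0) ey].
have := dir_dot th j k; rewrite ex ey -!expr2 dir_norm turn_cosE ?ltn_pmod //.
case: ifP => [/eqP + _|_].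
  by case: j {ex ey} => -[|[|[|[|[|//]]]]] hj; case: k => -[|[|[|[|[|//]]]]] hk //= _;
    apply: val_inj.
have := turn_cos1_gt0 R; have := turn_cos1_eq R; have := turn_cos2_lin R.
by case: ifP => _ c20 c1e c0 e; exfalso; move: e; rewrite ?c20; nra.
Qed.

Lemma spoke_neq i j : i != j %[mod 5] -> spoke th rho i <> spoke th rho j.
Proof.
move=> ij; rewrite -[spoke _ _ i]spoke_mod -[spoke _ _ j]spoke_mod => e.
have := @spoke_inj (inord (i %% 5)) (inord (j %% 5)).
rewrite !inordK ?ltn_pmod // => /(_ e)/(congr1 val); rewrite /= !inordK ?ltn_pmod //.
by move/eqP: ij.
Qed.

Lemma line_diagonal k :
  line_through (spoke th rho k) (spoke th rho (k + 2)) = diag_line (spoke th rho (k + 1)).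
Proof.
have mod1 : ((k + 4 * (k + 1)) %% 5 = 4)%N.
  by rewrite (_ : k + 4 * (k + 1) = k * 5 + 4)%N ?modnMDl // mulnDr; lia.
have mod2 : (((k + 2) + 4 * (k + 1)) %% 5 = 1)%N.
  by rewrite (_ : (k + 2) + 4 * (k + 1) = k.+1 * 5 + 1)%N ?modnMDl //; lia.
have d1 : diag_line (spoke th rho (k + 1)) (spoke th rho k).
  by rewrite diagonal_spoke mod1 -(@turn_cosN _ 1).
have d2 : diag_line (spoke th rho (k + 1)) (spoke th rho (k + 2)).
  by rewrite diagonal_spoke mod2.
have neq : spoke th rho k <> spoke th rho (k + 2) by apply: spoke_neq; lia.
pose p := spoke th rho (k + 1); pose n := (p.1 - O.1, p.2 - O.2).
pose e := c1 * (n.1 ^+ 2 + n.2 ^+ 2) + (n.1 * O.1 + n.2 * O.2).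
have diagE x : diag_line p x <-> n.1 * x.1 + n.2 * x.2 = e.
  rewrite /diag_line /= /e /n /=; split=> h; first by rewrite -h; ring.
  by apply: (@addIr _ (n.1 * O.1 + n.2 * O.2)); rewrite /n /= -h; ring.
rewrite (@eq_line _ _ _ n e) //.
- by apply/seteqP; split=> x /diagE.
- exact/diagE.
- exact/diagE.
rewrite /n /p /spoke /= ![_ + _ - O.1]addrC ![_ + _ - O.2]addrC !addKr !exprMn.
by rewrite -mulrDr dir_norm mulr1 expf_neq0.
Qed.

Lemma regular_pentagon_spokes : regular_pentagon O (pentagon th rho).
Proof.
have [neg|pos|zero] := ltgtP rho 0.
- exists (fun k : 'I_5 => spoke th rho k) => //.
  exists (- rho), (th + pi); split; first by rewrite oppr_gt0.
  by move=> k; rewrite (addrAC th) cosDpi sinDpi !mulrNN.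
- by exists (fun k : 'I_5 => spoke th rho k) => //; exists rho, th.
- by have := rho0; rewrite zero eqxx.
Qed.
End Fixed.

Lemma regular_pentagonP P : regular_pentagon O P ->
  exists th rho, rho != 0 /\ P = pentagon th rho.
Proof.
move=> [v [r [th [r0 vE]]] ->]; exists th, r; split; first by rewrite gt_eqF.
by apply/eq_imagel => k _; rewrite vE.
Qed.

(** Each diagonal is determined by the vertex it cuts off, so that it does not depend
    on the labelling of the pentagon. *)
Lemma pentagram_diagonals th rho : rho != 0 ->
  pentagram O (pentagon th rho) = diag_line @` pentagon th rho.
Proof.
move=> rho0.
have label v r t : 0 < r -> (forall k : 'I_5, v k =
      (O.1 + r * cos (t + 2 * pi * (k : nat)%:R / 5),
       O.2 + r * sin (t + 2 * pi * (k : nat)%:R / 5))) ->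
    forall k : 'I_5, line_through (v k) (v (k + 2)) = diag_line (v (k + 1)).
  move=> r0 vE k; have vS (j : 'I_5) : v j = spoke t r j by rewrite vE.
  have -> : v (k + 2) = spoke t r (k + 2)%N by rewrite vS -[RHS]spoke_mod.
  have -> : v (k + 1) = spoke t r (k + 1)%N by rewrite vS -[RHS]spoke_mod.
  by rewrite vS line_diagonal ?gt_eqF.
apply/seteqP; split=> [l [v [[r [t [r0 vE]]] PE [k ->]]]|_ [p pP <-]].
  by exists (v (k + 1)); [rewrite PE; exists (k + 1)|rewrite -(label _ _ _ r0 vE)].
have [v vl PE] := regular_pentagon_spokes th rho0.
have [r [t [r0 vE]]] := vl; exists v; split=> //.
move: pP; rewrite PE => -[j _ <-]; exists (j - 1).
by rewrite (label _ _ _ r0 vE) subrK.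
Qed.

Lemma dir_indep th (i j : 'I_5) (a b : R) : i != j ->
  a * dirx th i + b * diry th i = 0 -> a * dirx th j + b * diry th j = 0 ->
  a = 0 /\ b = 0.
Proof.
move=> ij ei ej.
have c0 := turn_cos1_gt0 R; have c1e := turn_cos1_eq R; have c2e := turn_cos2_lin R.
have D0 : dirx th i * diry th j - diry th i * dirx th j != 0.
  apply: contra_neq ij => D0.
  have : turn_cos R ((i + 4 * j) %% 5) ^+ 2 = 1.
    rewrite -(dir_dot th) -[RHS]mulr1 -{1}(dir_norm th i) -(dir_norm th j).
    rewrite -[RHS]subr0 -[X in _ = _ - X](expr0n _ 2) -D0; ring.
  rewrite turn_cosE ?ltn_pmod //; case: ifP => [/eqP h _|_].
    by apply: val_inj => /=; have := ltn_ord i; have := ltn_ord j; lia.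
  by case: ifP => _; rewrite ?c2e => ?; exfalso; nra.
split; apply: (mulIf D0); rewrite mul0r.
  transitivity ((a * dirx th i + b * diry th i) * diry th j
    - (a * dirx th j + b * diry th j) * diry th i); first by ring.
  by rewrite ei ej !mul0r subrr.
transitivity ((a * dirx th j + b * diry th j) * dirx th i
  - (a * dirx th i + b * diry th i) * dirx th j); first by ring.
by rewrite ei ej !mul0r subrr.
Qed.

(** Two diagonals meet on the axis of their symmetry, whose index [k] satisfies
    [2 * k = i + j] modulo 5: at a vertex of the pentagon or at a vertex of the
    smaller one. *)
Lemma diagonal_meet th rho (i j : 'I_5) x : rho != 0 -> i != j ->
  diag_line (spoke th rho i) x -> diag_line (spoke th rho j) x ->
  exists k : nat, x = spoke th rho k \/ x = spoke th (rho * (c1 / c2)) k.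
Proof.
move=> rho0 ij xi xj; pose k := (3 * (i + j))%N; exists k.
pose kap := turn_cos R ((k + 4 * i) %% 5).
have kapE : turn_cos R ((k + 4 * j) %% 5) = kap.
  rewrite /kap -[RHS]turn_cosN; last by rewrite ltnW ?ltn_pmod.
  by rewrite -[RHS]turn_cos_mod; congr turn_cos; rewrite /k; lia.
have kap0 : kap != 0 by exact: turn_cos_neq0.
have [z1 z2] : (x.1 - O.1) - rho * c1 / kap * dirx th k = 0 /\
               (x.2 - O.2) - rho * c1 / kap * diry th k = 0.
  have step (l : nat) : turn_cos R ((k + 4 * l) %% 5) = kap ->
      diag_line (spoke th rho l) x ->
      (x.1 - O.1 - rho * c1 / kap * dirx th k) * dirx th l +
      (x.2 - O.2 - rho * c1 / kap * diry th k) * diry th l = 0.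
    move=> kapl /(diagonalE _ rho0) xl.
    transitivity ((x.1 - O.1) * dirx th l + (x.2 - O.2) * diry th l
      - rho * c1 / kap * (dirx th k * dirx th l + diry th k * diry th l)); first by ring.
    by rewrite xl dir_dot kapl divfK ?subrr.
  exact: (dir_indep ij (step _ erefl xi) (step _ kapE xj)).
have xE : x = spoke th (rho * (c1 / kap)) k.
  rewrite [x]surjective_pairing /spoke /= mulrA.
  by congr (_, _); apply/eqP; rewrite -subr_eq0 opprD addrA ?z1 ?z2.
move: xE; rewrite /kap [turn_cos R (_ %% 5)]turn_cosE ?ltn_pmod //; case: ifP => [/eqP h|_].
  by case/eqP: ij; apply: val_inj; move: h (ltn_ord i) (ltn_ord j); rewrite /k /=; lia.
case: ifP => _ ->; [by right|left].
by rewrite divff ?mulr1 // turn_cos_neq0.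
Qed.

Lemma next_ring_pentagon th rho : rho != 0 ->
  next_ring O (pentagon th rho) = pentagon th (rho * (c1 / c2)).
Proof.
move=> rho0; have c0 := turn_cos1_gt0 R; have c1e := turn_cos1_eq R.
have c2e := turn_cos2_lin R; have c20 := turn_cos_neq0 R 2.
rewrite /next_ring pentagram_diagonals //; apply/seteqP; split=> x.
  move=> [[l [l' [[p /pentagonP[i ->] <-] [q /pentagonP[j ->] <-] neq xi xj]]] xP].
  have ij : inord (i %% 5) != inord (j %% 5) :> 'I_5.
    apply: contra_notN neq => /eqP/(congr1 val)/=; rewrite !inordK ?ltn_pmod // => e.
    by rewrite -spoke_mod e spoke_mod.
  have [] := @diagonal_meet th rho (inord (i %% 5)) (inord (j %% 5)) x rho0 ij.
  - by rewrite inordK ?ltn_pmod // spoke_mod.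
  - by rewrite inordK ?ltn_pmod // spoke_mod.
  move=> k [xk|xk]; last by apply/pentagonP; exists k.
  by case: xP; apply/pentagonP; exists k.
move=> /pentagonP[k ->].
have mod3 : ((k + 4 * (k + 2)) %% 5 = 3)%N by lia.
have mod2 : ((k + 4 * (k + 3)) %% 5 = 2)%N by lia.
have mod1 : ((k + 1 + 4 * (k + 2)) %% 5 = 4)%N by lia.
have mod4 : ((k + 1 + 4 * (k + 3)) %% 5 = 3)%N by lia.
split.
  exists (diag_line (spoke th rho (k + 2))), (diag_line (spoke th rho (k + 3))); split.
  - by exists (spoke th rho (k + 2)) => //; apply/pentagonP; exists (k + 2)%N.
  - by exists (spoke th rho (k + 3)) => //; apply/pentagonP; exists (k + 3)%N.
  - move=> e; have : diag_line (spoke th rho (k + 2)) (spoke th rho (k + 1)).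
      by rewrite diagonal_spoke // mod1 (@turn_cosE R 4).
    rewrite e diagonal_spoke // mod4 (@turn_cosE R 3) //= => /(mulfI rho0).
    by rewrite c2e => h; lra.
  - by rewrite diagonal_spoke // mod3 (@turn_cosE R 3) //=; field.
  - by rewrite diagonal_spoke // mod2; field.
move=> /pentagonP[j [/addrI ex /addrI ey]].
have : (rho * (c1 / c2)) ^+ 2 = rho ^+ 2.
  rewrite -[LHS]mulr1 -[RHS]mulr1 -{1}(dir_norm th k) -(dir_norm th j).
  by rewrite !mulrDr -!exprMn ex ey.
move=> /eqP; rewrite exprMn -[X in _ == X]mulr1 => /eqP/(mulfI (expf_neq0 2 rho0)).
rewrite expr_div_n => /(congr1 (fun t => t * c2 ^+ 2)).
by rewrite divfK ?expf_neq0 // mul1r c2e => h; nra.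
Qed.
End Pentagrams.

Section Axes.
Context (R : realType) (O : plane R) (th rho : R).
Hypothesis rho0 : rho != 0.

Local Notation spoke := (spoke O th).
Local Notation P := (pentagon O th rho).

Lemma spoke_neq_center rho' k : rho' != 0 -> O <> spoke rho' k.
Proof.
move=> rho'0 /esym e; have e1 := congr1 fst e; have e2 := congr1 snd e.
move: e1 e2; rewrite /spoke /= => /eqP + /eqP.
rewrite -[X in _ == X]addr0 -[X in _ -> _ == X -> _]addr0 !(inj_eq (addrI _)).
rewrite !mulf_eq0 (negbTE rho'0) /= => /eqP x0 /eqP y0.
by have := dir_norm th k; rewrite x0 y0 expr0n addr0 => /eqP; rewrite eq_sym oner_eq0.
Qed.

Lemma reflection_spoke k j :
  reflection O (spoke rho k) (spoke rho j) = spoke rho (2 * k + 4 * j).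
Proof.
have dxE : dirx th (2 * k + 4 * j) =
    2 * (dirx th j * dirx th k + diry th j * diry th k) * dirx th k - dirx th j.
  by rewrite dir_dot -dirx_refl addrK.
have dyE : diry th (2 * k + 4 * j) =
    2 * (dirx th j * dirx th k + diry th j * diry th k) * diry th k - diry th j.
  by rewrite dir_dot -diry_refl addrK.
rewrite /reflection /foot /spoke /= dxE dyE ![_ + _ - O.1]addrC ![_ + _ - O.2]addrC !addKr.
have -> : (rho * dirx th k) ^+ 2 + (rho * diry th k) ^+ 2 = rho ^+ 2.
  by rewrite !exprMn -mulrDr dir_norm mulr1.
by congr (_, _); field.
Qed.

Lemma axis_spoke k : symmetry_axes P (line_through O (spoke rho k)).
Proof.
exists O, (spoke rho k); split=> //; first exact: spoke_neq_center.
have refP j : P (reflection O (spoke rho k) (spoke rho j)).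
  by rewrite reflection_spoke; apply/pentagonP; exists (2 * k + 4 * j)%N.
apply/seteqP; split=> [_ [_ [j _ <-] <-]|x /pentagonP[j ->]]; first exact: refP.
exists (reflection O (spoke rho k) (spoke rho j)); first exact: refP.
exact: (reflectionK (@spoke_neq_center rho k rho0)).
Qed.

(** A reflection preserving the pentagon fixes its centroid, and it sends the vertex
    of index 0 to one of some index [j], so that it fixes that of index [3 * j]. *)
Lemma axis_center_spoke l : symmetry_axes P l ->
  exists p q, [/\ p <> q, l = line_through p q, l O & exists k, forall rho', l (spoke rho' k)].
Proof.
move=> [p [q [pq lE Prefl]]]; exists p, q; rewrite lE line_throughE //.
pose u := q.1 - p.1; pose w := q.2 - p.2.
have areaE rho' k : area p q (spoke rho' k) =
    area p q O + rho' * (dirx th k * w - diry th k * u).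
  by rewrite /area /spoke /= /u /w; ring.
have /choice[s sE] : forall j : 'I_5, exists k : 'I_5,
    reflection p q (spoke rho j) = spoke rho k.
  move=> j; have : P (reflection p q (spoke rho j)).
    by rewrite -{1}Prefl; exists (spoke rho j) => //; exists j.
  by case=> k _ <-; exists k.
have s_inj : injective s.
  move=> i j sij; apply: (@spoke_inj _ O th rho rho0); apply: (can_inj (reflectionK pq)).
  by rewrite !sE sij.
have areaN (j : 'I_5) : area p q (spoke rho (s j)) = - area p q (spoke rho j).
  by rewrite -sE area_reflection.
have sumE : \sum_(j < 5) area p q (spoke rho j) = 5 * area p q O.
  under eq_bigr => j _ do rewrite areaE.
  rewrite big_split /= sumr_const card_ord -mulr_sumr.
  have [sx sy] := dir_sum th.
  by rewrite sumrB -!mulr_suml sx sy !mul0r subrr mulr0 addr0 mulr_natl.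
have O0 : area p q O = 0.
  have : \sum_(j < 5) area p q (spoke rho j) = - \sum_(j < 5) area p q (spoke rho j).
    rewrite -sumrN (reindex_inj s_inj) /=.
    by apply: eq_bigr => j _; rewrite areaN.
  by rewrite sumE; lra.
split=> //; pose j := s ord0; exists (3 * j)%N => rho'; rewrite /= areaE O0 add0r.
have := areaN ord0; rewrite -/j !areaE O0 !add0r => jE.
have : rho * ((dirx th 0 + dirx th j) * w - (diry th 0 + diry th j) * u) = 0.
  have -> : rho * ((dirx th 0 + dirx th j) * w - (diry th 0 + diry th j) * u) =
    rho * (dirx th j * w - diry th j * u) + rho * (dirx th 0 * w - diry th 0 * u) by ring.
  by rewrite jE addNr.
have -> : dirx th 0 = dirx th (2 * (3 * j) + 4 * j) by rewrite -[RHS]dirx_mod; congr dirx; lia.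
have -> : diry th 0 = diry th (2 * (3 * j) + 4 * j) by rewrite -[RHS]diry_mod; congr diry; lia.
rewrite dirx_refl diry_refl; set t := turn_cos _ _ => e.
have t0 : 2 * t != 0 by rewrite mulf_neq0 ?turn_cos_neq0 ?pnatr_eq0.
apply: (mulfI (mulf_neq0 t0 rho0)); rewrite mulr0 -[RHS](mulr0 rho') -[in RHS]e; ring.
Qed.
End Axes.

(** * Completions of Euclidean lines *)

Section Completion.
Context (R : realType).
Implicit Types p q x : plane R.

Lemma homogeneousE x (a : R) : a *: homogeneous x = \row_(i < 3) [:: a * x.1; a * x.2; a]`_i.
Proof.
by apply/rowP => -[[|[|[|//]]] hi]; rewrite !mxE //= mulr1.
Qed.

Lemma homogeneous_neq0 x : homogeneous x != 0.
Proof. by have := dim_homogeneous x; rewrite dim_vline eqb1. Qed.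

Lemma embedE x : embed x = pt (homogeneous x).
Proof. by apply: val_inj; rewrite val_pt ?homogeneous_neq0. Qed.

Lemma homogeneous_not_line p q : p <> q -> homogeneous q \notin <[homogeneous p]>%VS.
Proof.
move=> pq; apply/vlineP => -[a /rowP qE]; apply: pq.
have := qE ord0; have := qE (inord 1); have := qE ord_max.
rewrite !mxE !inordK //= => a1; rewrite mulr1 in a1; rewrite -a1 !mul1r => e2 e1.
by rewrite [p]surjective_pairing [q]surjective_pairing e1 e2.
Qed.

Lemma dim_homogeneous2 p q : p <> q ->
  \dim (<[homogeneous p]> + <[homogeneous q]>) = 2%N.
Proof.
move=> pq; apply/eqP; rewrite eqn_leq; apply/andP; split.
  have [+ _] := dimv_add_leqif <[homogeneous p]>%VS <[homogeneous q]>%VS.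
  by rewrite !dim_vline !homogeneous_neq0.
rewrite ltnNge; apply: contra (homogeneous_not_line pq) => d1.
have /eqP -> : (<[homogeneous p]> == <[homogeneous p]> + <[homogeneous q]>)%VS.
  by rewrite eqEdim addvSl dim_vline homogeneous_neq0.
by rewrite memvE addvSr.
Qed.

Lemma homogeneous_line p q a b x : p <> q -> a <> b ->
  line_through p q a -> line_through p q b -> line_through p q x ->
  exists s t, homogeneous x = s *: homogeneous a + t *: homogeneous b.
Proof.
move=> pq ab [ta _ aE] [tb _ bE] [t _ <-].
have tab : tb - ta != 0.
  by rewrite subr_eq0; apply/eqP => tE; apply: ab; rewrite -aE -bE tE.
exists ((tb - t) / (tb - ta)), ((t - ta) / (tb - ta)); rewrite !homogeneousE.
by apply/rowP => -[[|[|[|//]]] hi]; rewrite !mxE //= -?aE -?bE /=; field.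
Qed.

(** A projective line containing the embedded line is the plane spanned by the
    coordinates of any two of its points. *)
Lemma completion_line p q a b l : p <> q -> a <> b ->
  line_through p q a -> line_through p q b ->
  (proj_line l /\ @embed R @` line_through p q `<=` l) <->
  l = pln (homogeneous a) (homogeneous b).
Proof.
move=> pq ab pa pb; split=> [[[U dU ->] sub]|->]; last first.
  split; first by exists (<[homogeneous a]> + <[homogeneous b]>)%VS; rewrite ?dim_homogeneous2.
  move=> _ [x px <-]; rewrite embedE; apply/plnP; first exact: homogeneous_neq0.
  by have [s [t ->]] := homogeneous_line pq ab pa pb px; exists s, t.
rewrite /pln; have -> // : U = (<[homogeneous a]> + <[homogeneous b]>)%VS.
apply/eqP; rewrite eq_sym eqEdim dim_homogeneous2 // dU leqnn andbT subv_add.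
by apply/andP; split; [apply: (sub (embed a)); exists a|apply: (sub (embed b)); exists b].
Qed.
End Completion.

(** * The double pentagram is a hemi-icosahedron *)

Section DoublePentagram.
Context (R : realType) (O : plane R) (th r : R).
Hypothesis r0 : r != 0.

Local Notation c1 := (turn_cos R 1).
Local Notation c2 := (turn_cos R 2).
Local Notation s5 := (Num.sqrt (5 : R)).
Local Notation spoke := (spoke O th).
Local Notation pentagon := (pentagon O th).

(** The signed radii of the middle and inner rings: the ratio [c1 / c2] is minus the
    inverse square of the golden ratio. *)
Definition middle : R := r * (c1 / c2).
Definition inner : R := middle * (c1 / c2).

Lemma ratio_neq0 : c1 / c2 != 0.
Proof. by rewrite mulf_neq0 ?invr_neq0 ?turn_cos_neq0. Qed.

Lemma middle_neq0 : middle != 0.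
Proof. by rewrite mulf_neq0 ?ratio_neq0. Qed.

(** Homogeneous coordinates, suitably scaled, of the centre (index 5) and of the
    middle ring. *)
Definition six (i : 'I_6) : 'rV[R]_3 :=
  if (i < 5)%N then homogeneous (spoke middle i) else s5 *: homogeneous O.

(** The affine change of coordinates taking the centre to the origin and the middle
    ring to a circle of radius 2. *)
Definition coords : 'M[R]_3 := \matrix_(i < 3)
  (nth 0 [:: \row_(j < 3) [:: 2 / middle; 0; 0]`_j;
             \row_(j < 3) [:: 0; 2 / middle; 0]`_j;
             \row_(j < 3) [:: - (2 / middle * O.1); - (2 / middle * O.2); 1]`_j] i).

Lemma coordsE x : homogeneous x *m coords =
  \row_(j < 3) [:: 2 / middle * (x.1 - O.1); 2 / middle * (x.2 - O.2); 1]`_j.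
Proof.
apply/rowP => j; rewrite !mxE !big_ord_recl big_ord0 !mxE /=.
by case: j => -[|[|[|//]]] hj /=; ring.
Qed.

Lemma coords_spoke k : homogeneous (spoke middle k) *m coords =
  \row_(j < 3) [:: 2 * dirx th k; 2 * diry th k; 1]`_j.
Proof.
have m0 := middle_neq0.
rewrite coordsE /spoke /=; apply/rowP => j; rewrite !mxE.
by case: j => -[|[|[|//]]] hj /=; field.
Qed.

Lemma coords_center : (s5 *: homogeneous O) *m coords = \row_(j < 3) [:: 0; 0; s5]`_j.
Proof.
rewrite -scalemxAl coordsE; apply/rowP => j; rewrite !mxE.
by case: j => -[|[|[|//]]] hj /=; ring.
Qed.

(** After the change of coordinates the six vectors are [(0, 0, sqrt 5)] and the
    [(2 cos, 2 sin, 1)], whose products are [4 * cos t + 1] for the angles [t]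
    between the points of the middle ring. *)
Lemma six_gram i j : six i *m (coords *m coords^T) *m (six j)^T = (gram R i j)%:M.
Proof.
have s2 := sqr_s5 R; have s5E := sqrt5E R; have c2E := turn_cos2_lin R.
rewrite mulmxA -mulmxA -trmx_mul [LHS]mx11_scalar; congr _%:M.
have row3 (a b c a' b' c' : R) : ((\row_(k < 3) [:: a; b; c]`_k) *m
    (\row_(k < 3) [:: a'; b'; c']`_k)^T) 0 0 = a * a' + b * b' + c * c'.
  by rewrite !mxE !big_ord_recl big_ord0 !mxE /= addr0 addrA.
have i6 := ltn_ord i; have j6 := ltn_ord j.
rewrite /six; case: ltnP => i5; case: ltnP => j5;
  rewrite ?coords_spoke ?coords_center row3 /gram /sgn /sneg.
- have -> : 2 * dirx th i * (2 * dirx th j) + 2 * diry th i * (2 * diry th j) + 1 * 1 =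
    4 * turn_cos R ((i + 4 * j) %% 5) + 1 by rewrite -(dir_dot th); ring.
  rewrite i5 j5 turn_cosE ?ltn_pmod //=.
  have -> : ((i + 4 * j) %% 5 == 0)%N = (i == j :> nat) by apply/eqP/eqP; lia.
  case: eqP => _; first by ring.
  by case: ifP => _; rewrite ?expr0 ?expr1 s5E ?c2E; field.
- have -> : (i == j :> nat) = false by apply/eqP; lia.
  by rewrite [(j < 5)%N]ltnNge j5 andbF /= expr0; ring.
- have -> : (i == j :> nat) = false by apply/eqP; lia.
  by rewrite [(i < 5)%N]ltnNge i5 /= expr0; ring.
- have -> : (i == j :> nat) by apply/eqP; lia.
  by rewrite /= !mul0r !add0r -expr2 s2.
Qed.

Definition idx (k : nat) : 'I_6 := inord (k %% 5).

Lemma idxE k : idx k = (k %% 5)%N :> nat.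
Proof. by rewrite inordK // ltnS ltnW // ltn_pmod. Qed.

Lemma idx_small (i : 'I_6) : (i < 5)%N -> idx i = i.
Proof. by move=> i5; apply: val_inj; rewrite /= idxE modn_small. Qed.

Lemma six_idx k : six (idx k) = homogeneous (spoke middle k).
Proof. by rewrite /six idxE ltn_pmod // spoke_mod. Qed.

Lemma six_max : six ord_max = s5 *: homogeneous O.
Proof. by []. Qed.

Lemma vertex_idx k : vertex six (idx k) = embed (spoke middle k).
Proof. by rewrite /vertex six_idx embedE. Qed.

Lemma vertex_max : vertex six ord_max = embed O.
Proof.
by rewrite /vertex six_max embedE pt_scale ?homogeneous_neq0.
Qed.

Lemma ord6P (i : 'I_6) : i = ord_max \/ exists2 k, (k < 5)%N & i = idx k.
Proof.
have [i5|i5] := ltnP i 5; first by right; exists i => //; rewrite idx_small.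
by left; apply: val_inj; apply/eqP; rewrite eqn_leq i5 -ltnS ltn_ord.
Qed.

Lemma vertices_embed :
  vertices six = @embed R @` ([set O] `|` pentagon middle).
Proof.
apply/seteqP; split=> [_ [i _ <-]|_ [x [->|[k _ <-]] <-]].
- have [->|[k _ ->]] := ord6P i.
    by exists O; [left|rewrite vertex_max].
  by exists (spoke middle k); [right; apply/pentagonP; exists k|rewrite vertex_idx].
- by exists ord_max => //; exact: vertex_max.
- by exists (idx k) => //; exact: vertex_idx.
Qed.

Lemma dir_pair k :
  dirx th (k + 2) + dirx th (k + 3) = 2 * c2 * dirx th k /\
  diry th (k + 2) + diry th (k + 3) = 2 * c2 * diry th k.
Proof.
have e3 : ((k + 3) %% 5 = (2 * k + 4 * (k + 2)) %% 5)%N by lia.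
have e2 : ((k + 2 + 4 * k) %% 5 = 2)%N by lia.
split.
  by rewrite -(dirx_mod th (k + 3)) e3 dirx_mod addrC dirx_refl e2.
by rewrite -(diry_mod th (k + 3)) e3 diry_mod addrC diry_refl e2.
Qed.

Lemma homogeneous_inner k : s5 *: homogeneous O + homogeneous (spoke middle (k + 2)) +
    homogeneous (spoke middle (k + 3)) = (s5 + 2) *: homogeneous (spoke inner k).
Proof.
have [ex ey] := dir_pair k; have c20 := turn_cos_neq0 R 2.
have cE : 2 * c2 = (s5 + 2) * (c1 / c2).
  apply: (mulIf c20); rewrite mulrA divfK // sqrt5E turn_cos2_lin.
  by have := turn_cos1_eq R; lra.
rewrite !homogeneousE -[X in _ + X + _]scale1r -[X in _ + _ + X]scale1r !homogeneousE.
apply/rowP => -[[|[|[|//]]] hj]; rewrite !mxE /= /inner; last by ring.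
  transitivity ((s5 + 2) * O.1 + middle * (dirx th (k + 2) + dirx th (k + 3))).
    by ring.
  by rewrite ex cE; ring.
transitivity ((s5 + 2) * O.2 + middle * (diry th (k + 2) + diry th (k + 3))).
  by ring.
by rewrite ey cE; ring.
Qed.

Lemma homogeneous_outer k : homogeneous (spoke middle (k + 2)) +
  homogeneous (spoke middle (k + 3)) - homogeneous (spoke middle k) =
  homogeneous (spoke r k).
Proof.
have [ex ey] := dir_pair k; have c20 := turn_cos_neq0 R 2.
have cE : (c1 / c2) * (2 * c2 - 1) = 1.
  apply: (mulIf c20); rewrite mulrAC divfK // mul1r turn_cos2_lin.
  by have := turn_cos1_eq R; lra.
apply/rowP => -[[|[|[|//]]] hj]; rewrite !mxE /= ; last by ring.
  transitivity (O.1 + middle * (dirx th (k + 2) + dirx th (k + 3) - dirx th k)).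
    by ring.
  rewrite ex /middle; transitivity (O.1 + r * (c1 / c2 * (2 * c2 - 1)) * dirx th k).
    by ring.
  by rewrite cE mulr1.
transitivity (O.2 + middle * (diry th (k + 2) + diry th (k + 3) - diry th k)).
  by ring.
rewrite ey /middle; transitivity (O.2 + r * (c1 / c2 * (2 * c2 - 1)) * diry th k).
  by ring.
by rewrite cE mulr1.
Qed.

Lemma sneg_idx (j k : nat) : sneg (idx j) (idx k) = ((j + 4 * k) %% 5 \in [:: 2; 3])%N.
Proof.
rewrite /sneg !idxE !ltn_pmod //=.
by have -> : ((j %% 5 + 4 * (k %% 5)) %% 5 = (j + 4 * k) %% 5)%N by lia.
Qed.

Lemma sneg_max (j : nat) : sneg (@ord_max 5) j = false.
Proof. by []. Qed.

Lemma is_face_inner k : is_face ord_max (idx (k + 2)) (idx (k + 3)).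
Proof.
have e : ((k + 2 + 4 * (k + 3)) %% 5 = 4)%N by lia.
rewrite /is_face /tau sneg_idx !sneg_max e -!(inj_eq val_inj) /= !idxE.
by apply/and3P; split; lia.
Qed.

(** The inner ring is the set of the centres of the faces at the vertex 5, and the outer
    ring is the set of the centres of the other five faces. *)
Lemma face_inner k :
  face six ord_max (idx (k + 2)) (idx (k + 3)) = embed (spoke inner k).
Proof.
rewrite embedE -(@pt_scale _ (s5 + 2)) ?homogeneous_neq0 //.
rewrite -homogeneous_inner /face /face_vec /sgn !sneg_max !six_idx six_max.
by rewrite !scale1r.
Qed.

Lemma is_face_outer k : is_face (idx (k + 2)) (idx (k + 3)) (idx k).
Proof.
have e1 : ((k + 2 + 4 * (k + 3)) %% 5 = 4)%N by lia.
have e2 : ((k + 2 + 4 * k) %% 5 = 2)%N by lia.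
have e3 : ((k + 3 + 4 * k) %% 5 = 3)%N by lia.
rewrite /is_face /tau !sneg_idx e1 e2 e3 -!(inj_eq val_inj) /= !idxE.
by apply/and4P; split=> //; lia.
Qed.

Lemma face_outer k :
  face six (idx (k + 2)) (idx (k + 3)) (idx k) = embed (spoke r k).
Proof.
have e1 : ((k + 2 + 4 * (k + 3)) %% 5 = 4)%N by lia.
have e2 : ((k + 2 + 4 * k) %% 5 = 2)%N by lia.
rewrite embedE -homogeneous_outer /face /face_vec /sgn !sneg_idx e1 e2 !six_idx.
by rewrite scale1r scaleN1r.
Qed.

Lemma faces_embed :
  faces six = @embed R @` (pentagon r `|` pentagon inner).
Proof.
apply/seteqP; split=> [x|_ [x [[k _ <-]|[k _ <-]] <-]]; last 2 first.
- exists (idx (k + 2)), (idx (k + 3)), (idx k).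
  by rewrite face_outer; split=> //; exact: is_face_outer.
- exists ord_max, (idx (k + 2)), (idx (k + 3)).
  by rewrite face_inner; split=> //; exact: is_face_inner.
move=> /(faces_sorted six_gram)[i [j [k [f ij jk ->]]]].
have /and4P[_ _ _ t] := f; have [m m5] := sorted_face_word ij jk t.
have [p1 p2 p3 p4 p5] := face_perm six_gram (is_face_inner m).
have [q1 q2 q3 q4 q5] := face_perm six_gram (is_face_outer m).
have ord_idx (l : 'I_6) n : nat_of_ord l = (n %% 5)%N -> l = idx n.
  by move=> ln; apply: val_inj; rewrite /= idxE.
have ord_idxm (l : 'I_6) : nat_of_ord l = m -> l = idx m.
  by move=> lm; apply: val_inj; rewrite /= idxE modn_small.
have ord_5 (l : 'I_6) : nat_of_ord l = 5%N -> l = ord_max by move=> l5; apply: val_inj.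
have in_inner : (@embed R @` (pentagon r `|` pentagon inner)) (embed (spoke inner m)).
  by exists (spoke inner m) => //; right; apply/pentagonP; exists m.
have in_outer : (@embed R @` (pentagon r `|` pentagon inner)) (embed (spoke r m)).
  by exists (spoke r m) => //; left; apply/pentagonP; exists m.
rewrite -face_inner in in_inner; rewrite -face_outer in in_outer.
rewrite /face_word !inE; do ![case/orP] => /eqP[].
- by move=> /ord_idx-> /ord_idx-> /ord_5->; rewrite p2.
- by move=> /ord_idx-> /ord_idx-> /ord_5->; rewrite p5.
- by move=> /ord_idx-> /ord_idx-> /ord_idxm->.
- by move=> /ord_idx-> /ord_idx-> /ord_idxm->; rewrite q1.
- by move=> /ord_idx-> /ord_idxm-> /ord_idx->; rewrite q3.
- by move=> /ord_idx-> /ord_idxm-> /ord_idx->; rewrite q2.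
- by move=> /ord_idxm-> /ord_idx-> /ord_idx->; rewrite q4.
- by move=> /ord_idxm-> /ord_idx-> /ord_idx->; rewrite q5.
Qed.

Lemma middleE : next_ring O (pentagon r) = pentagon middle.
Proof. exact: next_ring_pentagon. Qed.

Lemma innerE : next_ring O (pentagon middle) = pentagon inner.
Proof. exact/next_ring_pentagon/middle_neq0. Qed.

Lemma points_embed :
  @embed R @` config_points O (pentagon r) = vertices six `|` faces six.
Proof.
rewrite vertices_embed faces_embed -image_setU /config_points middleE innerE.
by congr (_ @` _); rewrite -!setUA; congr (_ `|` _); rewrite setUCA.
Qed.

Lemma diagonal_line rho k : rho != 0 ->
  exists p q, p <> q /\ diag_line O (spoke rho k) = line_through p q.
Proof.
move=> rho0; exists (spoke rho (k + 4)), (spoke rho (k + 4 + 2)).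
have -> : spoke rho k = spoke rho (k + 4 + 1).
  by rewrite -[LHS]spoke_mod -[RHS]spoke_mod; congr (spoke _ _); lia.
by rewrite line_diagonal //; split=> //; apply: spoke_neq => //; lia.
Qed.

Lemma diagonal_completion rho k (i j : nat) l : rho != 0 -> i != j %[mod 5] ->
  diag_line O (spoke rho k) (spoke middle i) ->
  diag_line O (spoke rho k) (spoke middle j) ->
  (proj_line l /\ @embed R @` diag_line O (spoke rho k) `<=` l) <->
  l = edge six (idx i) (idx j).
Proof.
move=> rho0 ij; have [p [q [pq ->]]] := diagonal_line k rho0 => pi pj.
rewrite /edge !six_idx; apply: completion_line pq _ pi pj.
exact: (@spoke_neq _ O th _ middle_neq0 _ _ ij).
Qed.

Lemma axis_completion p q k l : p <> q ->
  line_through p q O -> line_through p q (spoke middle k) ->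
  (proj_line l /\ @embed R @` line_through p q `<=` l) <->
  l = edge six ord_max (idx k).
Proof.
move=> pq pO pk; rewrite /edge six_max six_idx.
rewrite -[homogeneous (spoke _ _)]scale1r pln_scale ?oner_neq0 //.
by apply: completion_line pq _ pO pk; apply: spoke_neq_center middle_neq0.
Qed.

(** The axes join the centre to the middle ring; the lines of the outer pentagram
    contain the sides of the middle pentagon, and those of the inner pentagram
    its diagonals. *)
Lemma edges_completions :
  completions (config_lines O (pentagon r)) = edges six.
Proof.
have m0 := middle_neq0; have c20 := turn_cos_neq0 R 2.
have mid2 : middle * c2 = r * c1 by rewrite /middle mulrA divfK.
rewrite /config_lines middleE !pentagram_diagonals //.
have outer_diag k j : ((j + 4 * k) %% 5 \in [:: 2; 3])%N ->
    diag_line O (spoke r k) (spoke middle j).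
  by rewrite diagonal_spoke // turn_cosE ?ltn_pmod // => h; case: eqP h => [->//|_ ->].
have inner_diag k j : ((j + 4 * k) %% 5 \in [:: 1; 4])%N ->
    diag_line O (spoke middle k) (spoke middle j).
  rewrite diagonal_spoke // [turn_cos R (_ %% 5)]turn_cosE ?ltn_pmod //.
  by rewrite !inE => /orP[] /eqP ->.
have edge_idx i j : i != j %[mod 5] -> edges six (edge six (idx i) (idx j)).
  move=> ij; exists (idx i), (idx j); split=> //.
  by rewrite -(inj_eq val_inj) /= !idxE.
have max_idx j : ord_max != idx j.
  by rewrite -(inj_eq val_inj) /= idxE; lia.
apply/seteqP; split=> [l [lp [m [[|] [_ /pentagonP[k ->] <-]|mA] lm]]|l [i [j [ij ->]]]].
- have ij : (k + 2 != k + 3 %[mod 5])%N by lia.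
  suff -> : l = edge six (idx (k + 2)) (idx (k + 3)) by exact: edge_idx.
  by apply/(diagonal_completion (k := k) _ r0 ij) => //; apply: outer_diag; rewrite !inE; lia.
- have ij : (k + 1 != k + 4 %[mod 5])%N by lia.
  suff -> : l = edge six (idx (k + 1)) (idx (k + 4)) by exact: edge_idx.
  by apply/(diagonal_completion (k := k) _ m0 ij) => //; apply: inner_diag; rewrite !inE; lia.
- have [p [q [pq mE mO [k mk]]]] := axis_center_spoke r0 mA.
  exists ord_max, (idx k); split; first exact: max_idx.
  rewrite mE in lm mO mk.
  by apply/(axis_completion _ pq mO (mk middle)).
wlog j5 : i j ij / (j < 5)%N.
  move=> thm; case: (ltnP j 5) => [|j5]; first exact: thm.
  rewrite /edge plnC; apply: thm; first by rewrite eq_sym.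
  rewrite ltnNge; apply: contra ij => i5; apply/eqP; apply: val_inj.
  by apply/eqP; rewrite /= eqn_leq !(leq_trans (leq_ord _)).
rewrite -(idx_small j5); have [iE|[i' i5 iE]] := ord6P i; rewrite iE.
  have axis_spoke_on rho : line_through O (spoke r j) (spoke rho j).
    rewrite line_throughE; last exact: spoke_neq_center.
    by rewrite /= /area /spoke /=; ring.
  have axis_O : line_through O (spoke r j) O.
    rewrite line_throughE; last exact: spoke_neq_center.
    by rewrite /= /area; ring.
  have rj := @spoke_neq_center _ O th r j r0.
  have [lp lm] := proj2 (axis_completion _ rj axis_O (axis_spoke_on middle)) erefl.
  by split=> //; exists (line_through O (spoke r j)) => //; right; exact: axis_spoke.
have i'j : (i' != j %[mod 5])%N.
  move: ij; rewrite iE -(inj_eq val_inj) /= idxE; lia.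
pose k := (3 * (i' + j))%N.
have [t|t] := boolP ((i' + 4 * k) %% 5 \in [:: 2; 3])%N.
  have ki : diag_line O (spoke r k) (spoke middle i') by exact: outer_diag.
  have kj : diag_line O (spoke r k) (spoke middle j).
    by apply: outer_diag; move: t; rewrite !inE /k; lia.
  have [lp lm] := proj2 (diagonal_completion _ r0 i'j ki kj) erefl.
  split=> //; exists (diag_line O (spoke r k)) => //.
  by left; left; exists (spoke r k) => //; apply/pentagonP; exists k.
have ki : diag_line O (spoke middle k) (spoke middle i').
  by apply: inner_diag; move: t; rewrite !inE /k; lia.
have kj : diag_line O (spoke middle k) (spoke middle j).
  by apply: inner_diag; move: t; rewrite !inE /k; lia.
have [lp lm] := proj2 (diagonal_completion _ m0 i'j ki kj) erefl.
split=> //; exists (diag_line O (spoke middle k)) => //.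
by left; right; exists (spoke middle k) => //; apply/pentagonP; exists k.
Qed.
End DoublePentagram.

Theorem mainTheorem6 (R : realType) (O : plane R) (P : set (plane R))
    (hP : regular_pentagon O P) :
  let X := @embed R @` config_points O P in
  let L := completions (config_lines O P) in
  [/\ isomorphic (stabilizer X L) [subg 'Alt_('I_5)],
      L #= `I_15,
      forall l1 l2, L l1 -> L l2 -> exists g : stabilizer X L, g @` l1 = l2
    & let S6 := @embed R @` ([set O] `|` next_ring O P) in
      exists S10 : set (proj_plane R),
        [/\ S6 #= `I_6, S10 #= `I_10
          & [set stab_orbit X L x | x in X] = [set S6; S10]]].
Proof.
have [th [r [r0 ->]]] := regular_pentagonP hP; cbv zeta.
rewrite points_embed // edges_completions // middleE // -vertices_embed.
have gramY := six_gram O th r0; split.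
- exact: stab_Alt5 gramY.
- exact: card_edges gramY.
- exact: edges_trans gramY.
exists (faces (six O th r)); split.
- exact: card_vertices gramY.
- exact: card_faces gramY.
- exact: orbits_points gramY.
Qed.
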